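(* Let $r\leqslant 1$ be an integer coprime with $3$. Let $p$ be a prime such that $p\equiv -r\pmod{3}$ and $p\geqslant 3-r$. Then $$\sum_{k=0}^{p-1} (6k+r) \frac{\left(\frac{r}{3}\right)_k^6}{k!^6} \equiv \frac{(-1)^{r+1}\,80rp^4}{81}\cdot \frac{\Gamma_p\!\left(1+\frac{r}{3}\right)^2} {\Gamma_p\!\left(1+\frac{2r}{3}\right)^3 \Gamma_p\!\left(1-\frac{r}{3}\right)^4} \sum_{k=0}^{1-r}\frac{(r-1)_k\left(\frac{r}{3}\right)_k^3} {(1)_k\left(\frac{2r}{3}\right)_k^3} \pmod{p^5}.$$
   Context: For a number $a$ and a non-negative integer $k$, $(a)_k=a(a+1)\cdots(a+k-1)$ denotes the Pochhammer symbol, with $(a)_0=1$. $\Gamma_p$ denotes Morita's $p$-adic Gamma function: for positive integers $n$, $\Gamma_p(n)=(-1)^n\prod_{0<j<n,\ p\nmid j} j$, and $\Gamma_p$ is extended to $\mathbb{Z}_p$ by continuity (note $\frac{r}{3},\frac{2r}{3}\in\mathbb{Z}_p$ since $p\neq 3$). Congruences modulo $p^5$ are understood in $\mathbb{Z}_p$: two $p$-adic integers are congruent modulo $p^5$ if their difference lies in $p^5\mathbb{Z}_p$. *)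

(* Defs.v *)
From mathcomp Require Import all_boot all_order all_algebra.
Set Implicit Arguments. Unset Strict Implicit. Unset Printing Implicit Defensive.
Import Order.TTheory GRing.Theory Num.Theory.
Local Open Scope ring_scope.

Definition poch (a : rat) (k : nat) : rat := \prod_(i < k) (a + i%:R).

Definition Gammap (p n : nat) : int :=
  (-1) ^+ n * \prod_(1 <= j < n | ~~ (p %| j)%N) (j%:Z).

(* Congruence modulo p^k in Z_p for rationals: x - y lies in p^k Z_(p),
   i.e. the (reduced) numerator of x - y is divisible by p^k and its
   denominator is prime to p. *)
Definition padic_cong (p k : nat) (x y : rat) : bool :=
  ((p ^ k)%:Z %| numq (x - y))%Z && coprimez p%:Z (denq (x - y)).

(* g is an integer congruent to Gamma_p(a) modulo p^K, where a is a p-adic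
   integer (rational here) and Gamma_p(a) is defined by continuity:
   Gamma_p(n) ≡ g mod p^K for all positive integers n sufficiently close
   (p-adically) to a. *)
Definition Gammap_approx (p K : nat) (a : rat) (g : int) : Prop :=
  exists M : nat, forall n : nat, (0 < n)%N ->
    padic_cong p M (n%:R) a -> ((p ^ K)%:Z %| Gammap p n - g)%Z.

(* Main.v *)
Require Import Defs.
From mathcomp Require Import all_boot all_order all_algebra all_field.
From mathcomp Require Import ring zify.
Set Implicit Arguments. Unset Strict Implicit. Unset Printing Implicit Defensive.
Import Order.TTheory GRing.Theory Num.Theory.
Local Open Scope ring_scope.

(* Put a = r/3, m = (2p - r)/3 and t = -2p/3, so that a + t = -m, and let z be
   a primitive fifth root of unity.  Replacing the five upper parameters a by
   a + t z^i and the five lower parameters 1 by 1 - t z^i (0 <= i < 5) changes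
   each summand only through t^5, because prod_i (y + t z^i) = y^5 + t^5; hence
   it does not change the sum modulo p^5.  The deformed sum is a terminating
   very-well-poised 7F6, which the transformations of Whipple and Sears rewrite
   as (a)_{m+1} times a 4F3 having r - 1 among its upper parameters.  There the
   factor p^4 is visible: (a)_{m+1} contributes -t = 2p/3, and the remaining
   rising factorials contribute, for j = 2, 3, 4,
     p/3 - t (z + z^j) = (p/3) (1 + 2 (z + z^j)),
   the product of the last three factors being -5.  What is left is needed only
   modulo p, where z disappears and the p-adic Gamma values become
   factorials. *)

(** * Rising factorials and the Pfaff-Saalschütz summation *)

Section RisingFactorial.
Variable R : comNzRingType.
Implicit Types (x A B C D : R) (i j k m n : nat).

Definition rising x n : R := \prod_(i < n) (x + i%:R).

Lemma rising0 x : rising x 0 = 1.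
Proof. by rewrite /rising big_ord0. Qed.

Lemma risingS x n : rising x n.+1 = rising x n * (x + n%:R).
Proof. by rewrite /rising big_ord_recr. Qed.

Lemma risingD x m n : rising x (m + n) = rising x m * rising (x + m%:R) n.
Proof.
elim: n => [|n IHn]; first by rewrite addn0 rising0 mulr1.
by rewrite addnS !risingS IHn natrD addrA mulrA.
Qed.

Lemma risingSl x n : rising x n.+1 = x * rising (x + 1) n.
Proof. by rewrite -add1n risingD risingS rising0 mul1r addr0. Qed.

Lemma rising_rev x n : rising x n = (-1) ^+ n * rising (1 - x - n%:R) n.
Proof.
elim: n x => [|n IHn] x; first by rewrite !rising0 mulr1.
rewrite risingS IHn (risingSl (1 - x - _)) exprS.
have -> : 1 - x - n.+1%:R + 1 = 1 - x - n%:R :> R by ring.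
ring.
Qed.

Lemma rising_opp_eq0 n k : (n < k)%N -> rising (- n%:R) k = 0.
Proof.
by move=> nk; rewrite -(subnKC nk) risingD risingS addNr mulr0 mul0r.
Qed.

(* The denominators of the 3F2 are cleared, so that no genericity assumption is
   needed; similarly for the transformations below. *)
Lemma pfaff_saalschutz A B C D n : C = A + B + D ->
  \sum_(j < n.+1) 'C(n, j)%:R * rising A j * rising B j
     * rising (C + j%:R) (n - j) * rising D (n - j)
  = rising (C - A) n * rising (C - B) n.
Proof.
move=> defC; elim: n => [|n IHn].
  by rewrite big_ord1 subnn !rising0 bin0 !mulr1.
pose t j := 'C(n, j)%:R * rising A j * rising B j
     * rising (C + j%:R) (n - j) * rising D (n - j).
(* The two new factors on the right satisfy (C-A+n)(C-B+n) = (C+n+j)(D+n-j) + (A+j)(B+j) for every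
   j. The summand of index j+1 at level n+1 is then [X j.+1 + Y j], and the one of index 0 is
   [X 0]. *)
pose X j := t j * ((C + n%:R + j%:R) * (D + n%:R - j%:R)).
pose Y j := t j * ((A + j%:R) * (B + j%:R)).
have -> : rising (C - A) n.+1 * rising (C - B) n.+1
    = \sum_(j < n.+1) X j + \sum_(j < n.+1) Y j.
  rewrite !risingS -big_split /=.
  transitivity ((rising (C - A) n * rising (C - B) n)
      * ((C - A + n%:R) * (C - B + n%:R))); first by ring.
  rewrite -IHn mulr_suml; apply: eq_bigr => j _.
  rewrite /X /Y -/(t j) -mulrDr; congr (_ * _); rewrite defC; ring.
have -> : \sum_(j < n.+1) X j = X 0 + \sum_(j < n.+1) X j.+1.
  rewrite big_ord_recl /=; congr (_ + _); rewrite big_ord_recr /=.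
  by rewrite [X n.+1]/X /t bin_small // !mul0r addr0.
rewrite -addrA -big_split big_ord_recl /=; congr (_ + _).
  rewrite /X /t !bin0 !rising0 !subn0 !risingS; ring.
apply: eq_bigr => -[j /= ltjn] _; rewrite /bump /= add1n subSS.
case: (ltnP j n) => [ltj|lenj]; last first.
  have -> : j = n by apply/eqP; rewrite eqn_leq lenj -ltnS ltjn.
  by rewrite /X /Y /t subnn !rising0 !binn bin_small // !mul0r add0r !risingS; ring.
have [i defn] : exists i, (n = j.+1 + i)%N by exists (n - j.+1)%N; rewrite subnKC.
have bl : j.+1%:R * 'C(n, j.+1)%:R = i.+1%:R * 'C(n, j)%:R :> R.
  by rewrite -!natrM mul_bin_left defn; congr ((_ * _)%N%:R); lia.
rewrite /X /Y /t binS natrD.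
have -> : (n - j.+1)%N = i by lia.
have -> : (n - j)%N = i.+1 by lia.
rewrite (risingSl (C + j%:R)) !risingS.
have -> : rising (C + j%:R + 1) i = rising (C + j.+1%:R) i.
  by congr (rising _ _); ring.
set e1 := rising A j; set e2 := rising B j; set e3 := rising _ i.
set e4 := rising D i; set c1 := 'C(n, j.+1)%:R; set c0 := 'C(n, j)%:R.
have -> : n%:R = j.+1%:R + i%:R :> R by rewrite defn natrD.
apply/eqP; rewrite -subr_eq0; apply/eqP.
transitivity ((i.+1%:R * c0 - j.+1%:R * c1) *
   (e1 * (A + j%:R) * e2 * (B + j%:R) * e3 * e4 * (D + i%:R))).
  rewrite -[j.+1%:R]natr1 -[i.+1%:R]natr1; ring.
by rewrite -bl subrr mul0r.
Qed.

Lemma big_ord_shift (f : nat -> R) m j : (j <= m)%N ->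
    (forall k, (k < j)%N -> f k = 0) ->
  \sum_(k < m.+1) f k = \sum_(k < (m - j).+1) f (j + k)%N.
Proof.
move=> lejm f0; rewrite -!(big_mkord predT) /=.
rewrite (@big_cat_nat _ _ _ j) //=; last by apply: leqW.
rewrite big1_seq ?add0r => [|k]; last first.
  by rewrite mem_index_iota /= => ltkj; exact: f0.
rewrite -[X in index_iota X]add0n big_addn subSn //.
by rewrite big_mkord; apply: eq_bigr => k _; rewrite addnC.
Qed.

Lemma big_ord_trunc (f : nat -> R) k m : (k <= m)%N ->
    (forall j, (k < j)%N -> f j = 0) ->
  \sum_(j < m.+1) f j = \sum_(j < k.+1) f j.
Proof.
move=> lekm f0; rewrite -!(big_mkord predT) /=.
rewrite (@big_cat_nat _ _ _ k.+1) //= [X in _ + X]big1_seq ?addr0 // => j.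
by rewrite mem_index_iota /= => /andP[ltkj _]; exact: f0.
Qed.

(** Pfaff-Saalschütz with A = a+k, B = 1+a-b-c, C = 1+a-b and n = k. On the right, k enters only
    through ['C(k, j)] and (a+k)_j, and these are the factors that a very-well-poised weight absorbs
    by a shift of its parameters. *)
Lemma rising_pair_expand (a b c : R) m k : (k <= m)%N ->
  (rising b k * rising (1 + a - b + k%:R) (m - k))
    * (rising c k * rising (1 + a - c + k%:R) (m - k))
  = \sum_(j < m.+1) 'C(k, j)%:R * rising (a + k%:R) j *
     ((-1) ^+ j * rising (1 + a - b - c) j
       * rising (1 + a - b + j%:R) (m - j) * rising (1 + a - c + j%:R) (m - j)).
Proof.
move=> lekm; pose f j := 'C(k, j)%:R * rising (a + k%:R) j *
     ((-1) ^+ j * rising (1 + a - b - c) j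
       * rising (1 + a - b + j%:R) (m - j) * rising (1 + a - c + j%:R) (m - j)).
rewrite [RHS](big_ord_trunc (f := f) lekm) => [|j ltkj]; last first.
  by rewrite /f bin_small // !mul0r.
have defC : 1 + a - b = (a + k%:R) + (1 + a - b - c) + (c - a - k%:R) by ring.
transitivity ((-1) ^+ k * (rising (1 + a - b - (a + k%:R)) k *
     rising (1 + a - b - (1 + a - b - c)) k)
     * (rising (1 + a - b + k%:R) (m - k) * rising (1 + a - c + k%:R) (m - k))).
  rewrite (rising_rev b k).
  have -> : 1 + a - b - (a + k%:R) = 1 - b - k%:R by ring.
  have -> : 1 + a - b - (1 + a - b - c) = c by ring.
  ring.
rewrite -(pfaff_saalschutz k defC) mulr_sumr mulr_suml; apply: eq_bigr.
move=> -[j /= ltjk] _; have lejk : (j <= k)%N by rewrite -ltnS.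
have split_rising x : rising (x + j%:R) (m - j)
    = rising (x + j%:R) (k - j) * rising (x + k%:R) (m - k).
  have -> : (m - j = (k - j) + (m - k))%N by lia.
  by rewrite risingD -addrA -natrD subnKC.
rewrite /f !split_rising (rising_rev (c - a - k%:R)).
have -> : 1 - (c - a - k%:R) - (k - j)%:R = 1 + a - c + j%:R.
  by rewrite natrB //; ring.
have -> : (-1) ^+ k = (-1) ^+ j * (-1) ^+ (k - j) :> R by rewrite -exprD subnKC.
have sq : (-1) ^+ (k - j) * (-1) ^+ (k - j) = 1 :> R.
  by rewrite -exprMn mulrNN mulr1 expr1n.
set s := (-1) ^+ (k - j) in sq *.
transitivity (s * s * ('C(k, j)%:R * rising (a + k%:R) j *
     ((-1) ^+ j * rising (1 + a - b - c) j
       * (rising (1 + a - b + j%:R) (k - j) * rising (1 + a - b + k%:R) (m - k))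
       * (rising (1 + a - c + j%:R) (k - j) * rising (1 + a - c + k%:R) (m - k))))).
  ring.
by rewrite sq mul1r.
Qed.

Lemma bin_mul_bin m j k : ('C(m, j + k) * 'C(j + k, j) = 'C(m, j) * 'C(m - j, k))%N.
Proof.
case: (leqP (j + k) m) => [le|lt]; last first.
  rewrite bin_small // mul0n; case: (leqP j m) => ?; last by rewrite bin_small.
  by rewrite ['C(m - j, k)]bin_small ?muln0 //; lia.
have lejm : (j <= m)%N by lia.
have lek : (k <= m - j)%N by lia.
apply/eqP; rewrite -(eqn_pmul2r (fact_gt0 (m - (j + k)))).
rewrite -(eqn_pmul2r (fact_gt0 k)) -(eqn_pmul2r (fact_gt0 j)); apply/eqP.
have e1 := bin_fact le; have e2 := bin_fact (leq_addr k j).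
have e3 := bin_fact lejm; have e4 := bin_fact lek.
rewrite addKn in e2; rewrite -subnDA in e4.
transitivity m`!; last by rewrite -e3 -e4; nia.
by rewrite -e1 -e2; nia.
Qed.

End RisingFactorial.

(** * Very-well-poised sums: the 5F4 summation and Whipple's transformation *)

Section VeryWellPoised.
Variable K : fieldType.
Implicit Types (a b c d e : K) (j k m : nat).

(** In the usual notation this is a (a)_k (1+a/2)_k (-m)_k / ((a/2)_k (1+a+m)_k k!), the part of a
    terminating very-well-poised summand that does not involve the free parameters. Writing a+2k for
    the quotient of the two half-parameter factors avoids dividing by a/2. *)
Definition vwp a m k : K :=
  (-1) ^+ k * 'C(m, k)%:R * (a + (2 * k)%:R) * rising a k / rising (1 + a + m%:R) k.

Lemma rising_neq0 (x : K) n : (forall i, (i < n)%N -> x + i%:R != 0) -> rising x n != 0.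
Proof. by move=> x0; apply/prodf_neq0 => i _; apply: x0. Qed.

Lemma vwp_den_neq0 a m k : (forall n, a + n%:R != 0) -> rising (1 + a + m%:R) k != 0.
Proof.
move=> a0; apply: rising_neq0 => i _.
have -> : 1 + a + m%:R + i%:R = a + (1 + m + i)%:R by ring.
exact: a0.
Qed.

(** For m = n+1 the partial sums have a closed form proportional to ['C(n, k)], which vanishes at k
    = n+1. *)
Lemma vwp_sum a m : (forall n, a + n%:R != 0) ->
  \sum_(k < m.+1) vwp a m k = if m == 0%N then a else 0.
Proof.
move=> a0; case: m => [|n] /=.
  by rewrite big_ord1 /vwp /= !rising0 bin0 expr0 invr1; ring.
suff H k : \sum_(i < k.+1) vwp a n.+1 i =
    (-1) ^+ k * 'C(n, k)%:R * rising a k.+1 / rising (1 + a + n.+1%:R) k.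
  by rewrite H bin_small // mulr0 !mul0r.
elim: k => [|k IHk].
  by rewrite big_ord1 /vwp /= !bin0 !risingS !rising0 expr0 invr1; ring.
rewrite big_ord_recr /= IHk /vwp.
have nz := vwp_den_neq0 n.+1 k a0.
have nz' : 1 + a + n.+1%:R + k%:R != 0.
  have -> : 1 + a + n.+1%:R + k%:R = a + (1 + n.+1 + k)%:R by ring.
  exact: a0.
rewrite (risingS (1 + a + n.+1%:R) k) (risingS a k.+1) (risingS a k).
have bl : k.+1%:R * 'C(n, k.+1)%:R = (n%:R - k%:R) * 'C(n, k)%:R :> K.
  rewrite -natrM mul_bin_left natrM; case: (leqP k n) => [le|lt]; first by rewrite natrB.
  by rewrite bin_small // !mulr0.
rewrite binS natrD exprS.
set c1 := 'C(n, k.+1)%:R in bl *; set c0 := 'C(n, k)%:R in bl *.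
set u := rising (1 + _ + _) k in nz *; set v := rising a k.
apply/eqP; rewrite -subr_eq0; apply/eqP.
transitivity (((n%:R - k%:R) * c0 - k.+1%:R * c1)
  * ((-1) ^+ k * v * (a + k%:R) / (u * (1 + a + n.+1%:R + k%:R)))).
  by field; rewrite nz nat1r nz'.
by rewrite bl subrr mul0r.
Qed.

(** Multiplying by ['C(k, j)] and (a+k)_j turns the weight for (a, m) into a multiple of the weight
    for (a+2j, m-j), with the index lowered by j. The new sum is thus again very-well-poised. *)
Lemma vwp_shift a m j k : (forall n, a + n%:R != 0) -> (j <= m)%N ->
  vwp a m (j + k) * ('C(j + k, j)%:R * rising (a + (j + k)%:R) j)
  = (-1) ^+ j * 'C(m, j)%:R * rising a (2 * j) / rising (1 + a + m%:R) j
    * vwp (a + (2 * j)%:R) (m - j) k.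
Proof.
move=> a0 lejm; rewrite /vwp.
have nz := vwp_den_neq0 m (j + k) a0.
have -> : 1 + (a + (2 * j)%:R) + (m - j)%:R = 1 + a + m%:R + j%:R.
  by rewrite natrB //; ring.
rewrite risingD in nz *; move: nz; rewrite mulf_eq0 negb_or => /andP[nz1 nz2].
have bin2 : 'C(m, j + k)%:R * 'C(j + k, j)%:R
    = 'C(m, j)%:R * 'C(m - j, k)%:R :> K by rewrite -!natrM bin_mul_bin.
have ris2 : rising a (j + k) * rising (a + (j + k)%:R) j
    = rising a (2 * j) * rising (a + (2 * j)%:R) k.
  by rewrite -!risingD; congr rising; lia.
set u := rising _ j in nz1 *; set v := rising _ k in nz2 *.
transitivity ((-1) ^+ (j + k) * ('C(m, j + k)%:R * 'C(j + k, j)%:R)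
   * (rising a (j + k) * rising (a + (j + k)%:R) j) * (a + (2 * (j + k))%:R) / (u * v)).
  by rewrite /u; field; rewrite nz1 nz2.
rewrite bin2 ris2 exprD; field; rewrite nz1 nz2 //.
Qed.

Lemma vwp_sum_shift (f : nat -> K) a m j : (forall n, a + n%:R != 0) -> (j <= m)%N ->
  \sum_(k < m.+1) vwp a m k * ('C(k, j)%:R * rising (a + k%:R) j * f k)
  = (-1) ^+ j * 'C(m, j)%:R * rising a (2 * j) / rising (1 + a + m%:R) j
    * \sum_(k < (m - j).+1) vwp (a + (2 * j)%:R) (m - j) k * f (j + k)%N.
Proof.
move=> a0 lejm.
pose g k := vwp a m k * ('C(k, j)%:R * rising (a + k%:R) j * f k).
rewrite [LHS](big_ord_shift (f := g) lejm) => [|k ltkj]; last first.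
  by rewrite /g bin_small // !mul0r mulr0.
rewrite mulr_sumr; apply: eq_bigr => k _.
by rewrite /g [RHS]mulrA -vwp_shift // !mulrA.
Qed.

Lemma shift_neq0 a j : (forall n, a + n%:R != 0) -> forall n, a + j%:R + n%:R != 0.
Proof. by move=> a0 n; rewrite -addrA -natrD. Qed.

(** The terminating very-well-poised 5F4 summation. Expanding the pair d, e and exchanging the sums
    leaves inner sums of bare weights, and by [vwp_sum] only the one with j = m survives. *)
Lemma vwp5F4 a d e m : (forall n, a + n%:R != 0) ->
  \sum_(k < m.+1) vwp a m k *
     ((rising d k * rising (1 + a - d + k%:R) (m - k))
      * (rising e k * rising (1 + a - e + k%:R) (m - k)))
  = rising a m.+1 * rising (1 + a - d - e) m.
Proof.
move=> a0.
under eq_bigr => k _.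
  rewrite (rising_pair_expand a d e (leq_ord k)) mulr_sumr.
  over.
rewrite exchange_big big_ord_recr /= big1 ?add0r => [|[j /= ltjm] _]; last first.
  pose y := (-1) ^+ j * rising (1 + a - d - e) j * rising (1 + a - d + j%:R) (m - j)
     * rising (1 + a - e + j%:R) (m - j).
  rewrite (vwp_sum_shift (fun=> y) a0 (ltnW ltjm)) -mulr_suml vwp_sum.
    by rewrite subn_eq0 leqNgt ltjm /= mul0r mulr0.
  exact: shift_neq0.
pose y := (-1) ^+ m * rising (1 + a - d - e) m * rising (1 + a - d + m%:R) (m - m)
     * rising (1 + a - e + m%:R) (m - m).
rewrite (vwp_sum_shift (fun=> y) a0 (leqnn m)) -mulr_suml subnn vwp_sum; last first.
  exact: shift_neq0.
rewrite /= /y subnn !rising0 binn !mulr1.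
have nz := vwp_den_neq0 m m a0.
have -> : rising a (2 * m) = rising a m.+1 * rising (1 + a + m%:R) m / (a + (2 * m)%:R).
  apply/eqP; rewrite eq_sym; apply/eqP.
  have -> : 1 + a + m%:R = a + m.+1%:R by ring.
  rewrite -risingD addSn risingS; have -> : (m + m = 2 * m)%N by lia.
  by rewrite mulfK.
have sq : (-1) ^+ m * (-1) ^+ m = 1 :> K by rewrite -exprMn mulrNN mulr1 expr1n.
have nz2 := a0 (2 * m)%N.
set s := (-1) ^+ m in sq *.
transitivity (s * s * (rising a m.+1 * rising (1 + a - d - e) m)); last by rewrite sq mul1r.
by field; rewrite nz -natrM nz2.
Qed.

(** Whipple's transformation. Only the pair b, c is expanded; after the exchange, the inner sum over
    k is a 5F4 with parameters a+2j, d+j, e+j and length m-j. *)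
Lemma whipple7F6 a b c d e m : (forall n, a + n%:R != 0) ->
  \sum_(k < m.+1) vwp a m k *
     ((rising b k * rising (1 + a - b + k%:R) (m - k))
      * (rising c k * rising (1 + a - c + k%:R) (m - k))
      * ((rising d k * rising (1 + a - d + k%:R) (m - k))
      * (rising e k * rising (1 + a - e + k%:R) (m - k))))
  = rising a m.+1 * \sum_(j < m.+1) 'C(m, j)%:R * rising (1 + a - b - c) j
      * rising d j * rising e j * rising (1 + a - b + j%:R) (m - j)
      * rising (1 + a - c + j%:R) (m - j) * rising (1 + a - d - e) (m - j).
Proof.
move=> a0.
under eq_bigr => k _.
  rewrite (rising_pair_expand a b c (leq_ord k)) mulr_suml mulr_sumr.
  over.
rewrite exchange_big mulr_sumr /=; apply: eq_bigr => -[j /= ltjm] _.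
have lejm : (j <= m)%N by rewrite -ltnS.
pose y := (-1) ^+ j * rising (1 + a - b - c) j * rising (1 + a - b + j%:R) (m - j)
     * rising (1 + a - c + j%:R) (m - j).
pose f k := (rising d k * rising (1 + a - d + k%:R) (m - k))
      * (rising e k * rising (1 + a - e + k%:R) (m - k)).
transitivity (y * \sum_(k < m.+1) vwp a m k * ('C(k, j)%:R * rising (a + k%:R) j * f k)).
  by rewrite mulr_sumr; apply: eq_bigr => k _; rewrite /y /f; ring.
rewrite (vwp_sum_shift f a0 lejm).
pose a' := a + (2 * j)%:R.
transitivity (y * ((-1) ^+ j * 'C(m, j)%:R * rising a (2 * j) / rising (1 + a + m%:R) j *
   (rising d j * rising e j * (rising a' (m - j).+1
      * rising (1 + a' - (d + j%:R) - (e + j%:R)) (m - j))))).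
  congr (_ * (_ * _)); rewrite -vwp5F4; last exact: shift_neq0.
  rewrite mulr_sumr; apply: eq_bigr => -[k /= ltk] _.
  rewrite /f !risingD natrD subnDA.
  have shift x : 1 + a' - (x + j%:R) + k%:R = 1 + a - x + (j%:R + k%:R).
    by rewrite /a'; ring.
  by rewrite -/a' !shift; ring.
have -> : 1 + a' - (d + j%:R) - (e + j%:R) = 1 + a - d - e by rewrite /a'; ring.
have nz := vwp_den_neq0 m j a0.
have ris : rising a (2 * j) * rising a' (m - j).+1 = rising a m.+1 * rising (1 + a + m%:R) j.
  have -> : 1 + a + m%:R = a + m.+1%:R by ring.
  by rewrite -!risingD; congr rising; lia.
have sq : (-1) ^+ j * (-1) ^+ j = 1 :> K by rewrite -exprMn mulrNN mulr1 expr1n.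
rewrite /y; set s := (-1) ^+ j in sq *.
transitivity (s * s * (rising a (2 * j) * rising a' (m - j).+1) / rising (1 + a + m%:R) j *
  ('C(m, j)%:R * rising (1 + a - b - c) j
      * rising d j * rising e j * rising (1 + a - b + j%:R) (m - j)
      * rising (1 + a - c + j%:R) (m - j) * rising (1 + a - d - e) (m - j))).
  by field.
by rewrite sq ris mul1r mulfK.
Qed.

End VeryWellPoised.

(** * Sears's transformation of balanced terminating 4F3 sums *)

Section Sears.
Variable R : comNzRingType.
Implicit Types (a b c d e : R) (m : nat).

(** Two uses of Pfaff-Saalschütz: one expands (e)_j (g)_j (D+j)_{m-j}, and after the exchange of
    sums the other evaluates the inner sum. Its purpose is the new upper parameter b+c+d+e-m-2a-1,
    which the application makes equal to r-1. *)
Lemma sears4F3 a b c d e m :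
  \sum_(j < m.+1) 'C(m, j)%:R * rising (1 + a - b - c) j
      * rising d j * rising e j * rising (1 + a - b + j%:R) (m - j)
      * rising (1 + a - c + j%:R) (m - j) * rising (1 + a - d - e) (m - j)
  = \sum_(i < m.+1) 'C(m, i)%:R * rising d i * rising (d - a - m%:R) i
      * rising (b + c + d + e - m%:R - 2 * a - 1) i
      * rising (1 + a - d - b) (m - i) * rising (1 + a - d - c) (m - i)
      * rising (1 + a - d - e) (m - i).
Proof.
pose D := d + e - a - m%:R; pose g := 1 + a - b - c; pose h := e + g - D.
pose y i := rising (D - e) i * rising (D - g) i * rising (D + i%:R) (m - i).
have signK n : (-1) ^+ n * (-1) ^+ n = 1 :> R.
  by rewrite -exprMn mulrNN mulr1 expr1n.
have reflD i : (i <= m)%N -> rising (1 + a - d - e) (m - i)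
    = (-1) ^+ (m - i) * rising (D + i%:R) (m - i).
  move=> le; rewrite rising_rev; congr (_ * rising _ _).
  by rewrite natrB // /D; ring.
have expand j : (j <= m)%N -> rising e j * rising g j * rising (D + j%:R) (m - j)
    = \sum_(i < m.+1) 'C(j, i)%:R * rising h (j - i) * y i.
  move=> lejm; pose f i := 'C(j, i)%:R * rising h (j - i) * y i.
  rewrite [RHS](big_ord_trunc (f := f) lejm) => [|i ltji]; last first.
    by rewrite /f bin_small // !mul0r.
  have defD : D = (D - e) + (D - g) + h by rewrite /h; ring.
  transitivity (rising (D - (D - e)) j * rising (D - (D - g)) j * rising (D + j%:R) (m - j)).
    by rewrite !subKr.
  rewrite -(pfaff_saalschutz j defD) mulr_suml; apply: eq_bigr => -[i /= ltij] _.
  rewrite /f /y; have -> : (m - i = (j - i) + (m - j))%N by lia.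
  have lij : (i <= j)%N by [].
  rewrite risingD -[D + i%:R + _]addrA -natrD subnKC //; ring.
transitivity (\sum_(i < m.+1) y i * \sum_(j < m.+1) (-1) ^+ (m - j) *
   ('C(m, j)%:R * 'C(j, i)%:R * rising d j * rising h (j - i)
   * rising (1 + a - b + j%:R) (m - j) * rising (1 + a - c + j%:R) (m - j))).
  under [RHS]eq_bigr => i _ do rewrite mulr_sumr.
  rewrite exchange_big /=; apply: eq_bigr => -[j /= ltjm] _.
  rewrite reflD //.
  transitivity ((-1) ^+ (m - j) * 'C(m, j)%:R * rising d j
   * rising (1 + a - b + j%:R) (m - j) * rising (1 + a - c + j%:R) (m - j)
   * (rising e j * rising g j * rising (D + j%:R) (m - j))); first by rewrite /g; ring.
  by rewrite expand // mulr_sumr; apply: eq_bigr => i _; ring.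
apply: eq_bigr => -[i /= ltim] _; have leim : (i <= m)%N by [].
pose f j := (-1) ^+ (m - j) *
   ('C(m, j)%:R * 'C(j, i)%:R * rising d j * rising h (j - i)
   * rising (1 + a - b + j%:R) (m - j) * rising (1 + a - c + j%:R) (m - j)).
rewrite [X in _ * X](big_ord_shift (f := f) leim) => [|j ltji]; last first.
  by rewrite /f (bin_small ltji) mulr0 !mul0r mulr0.
pose n := (m - i)%N.
have defB : 1 + a - b + i%:R = (d + i%:R) + h + (c - a - m%:R).
  by rewrite /h /g /D; ring.
transitivity (y i * ('C(m, i)%:R * rising d i *
   (rising (1 + a - b + i%:R - (d + i%:R)) n * rising (1 + a - b + i%:R - h) n))).
  rewrite -(pfaff_saalschutz n defB) -/n; congr (_ * _); rewrite mulr_sumr.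
  apply: eq_bigr => -[j /= ltjn] _; have lejn : (j <= n)%N by [].
  rewrite /f addKn -natrM bin_mul_bin natrM -/n.
  have -> : (m - (i + j) = n - j)%N by rewrite /n; lia.
  rewrite risingD [rising (c - a - _) _]rising_rev.
  have -> : 1 - (c - a - m%:R) - (n - j)%:R = 1 + a - c + (i + j)%:R.
    by rewrite natrB // /n natrB // natrD; ring.
  by rewrite natrD addrA; ring.
have -> : 1 + a - b + i%:R - (d + i%:R) = 1 + a - d - b by ring.
rewrite [rising (1 + a - b + i%:R - h) n]rising_rev.
have -> : 1 - (1 + a - b + i%:R - h) - n%:R = 1 + a - d - c.
  by rewrite /n natrB // /h /g /D; ring.
rewrite reflD // -/n /y.
have -> : D - e = d - a - m%:R by rewrite /D; ring.
have -> : D - g = b + c + d + e - m%:R - 2 * a - 1 by rewrite /D /g; ring.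
by rewrite -/n; ring.
Qed.

End Sears.

Lemma vwp7F6 (K : fieldType) (a b c d e : K) m : (forall n, a + n%:R != 0) ->
  \sum_(k < m.+1) vwp a m k *
     ((rising b k * rising (1 + a - b + k%:R) (m - k))
      * (rising c k * rising (1 + a - c + k%:R) (m - k))
      * ((rising d k * rising (1 + a - d + k%:R) (m - k))
      * (rising e k * rising (1 + a - e + k%:R) (m - k))))
  = rising a m.+1 * \sum_(i < m.+1) 'C(m, i)%:R * rising d i * rising (d - a - m%:R) i
      * rising (b + c + d + e - m%:R - 2 * a - 1) i
      * rising (1 + a - d - b) (m - i) * rising (1 + a - d - c) (m - i)
      * rising (1 + a - d - e) (m - i).
Proof. by move=> a0; rewrite whipple7F6 // sears4F3. Qed.

(** * Congruences modulo powers of p between algebraic numbers *)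

Section LocalIntegrality.
Variable p : nat.
Hypothesis p_pr : prime p.
Implicit Types (x y : algC) (k n : nat).

(* The localisation at p of the ring of algebraic integers. *)
Definition pint x : Prop := exists2 n : nat, coprime p n & n%:R * x \in Aint.

Lemma pint_int (z : int) : pint z%:~R.
Proof. by exists 1%N; rewrite ?coprimen1 // mul1r rpred_int. Qed.

Lemma pint_nat n : pint n%:R.
Proof. exact: (pint_int n). Qed.

Lemma pint_Aint x : x \in Aint -> pint x.
Proof. by move=> Ax; exists 1%N; rewrite ?coprimen1 // mul1r. Qed.

Lemma pintM x y : pint x -> pint y -> pint (x * y).
Proof.
move=> [m cm Am] [n cn An]; exists (m * n)%N; first by rewrite coprimeMr cm.
by rewrite natrM mulrACA rpredM.
Qed.

Lemma pintD x y : pint x -> pint y -> pint (x + y).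
Proof.
move=> [m cm Am] [n cn An]; exists (m * n)%N; first by rewrite coprimeMr cm.
rewrite natrM mulrDr rpredD //.
  by rewrite mulrAC rpredM // rpred_nat.
by rewrite -mulrA rpredM // rpred_nat.
Qed.

Lemma pintN x : pint x -> pint (- x).
Proof. by rewrite -mulN1r => px; apply: pintM px; exact: (pint_int (-1)). Qed.

Lemma pintB x y : pint x -> pint y -> pint (x - y).
Proof. by move=> px py; apply: pintD => //; apply: pintN. Qed.

Lemma pintX x n : pint x -> pint (x ^+ n).
Proof.
move=> px; elim: n => [|n IHn]; first exact: (pint_int 1).
by rewrite exprS; apply: pintM.
Qed.

Lemma pint_sum (I : Type) (s : seq I) (P : pred I) (f : I -> algC) :
  (forall i, P i -> pint (f i)) -> pint (\sum_(i <- s | P i) f i).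
Proof. by move=> pf; elim/big_ind: _ => //; [exact: (pint_int 0) | exact: pintD]. Qed.

(** Being nonzero is demanded explicitly because the inverse of 0 is 0 by convention. *)
Definition punit x : Prop := [/\ x != 0, pint x & pint x^-1].

Lemma punit_int (z : int) : coprimez p z -> punit z%:~R.
Proof.
move=> cz; have z0 : z != 0.
  by apply: contraTneq cz => ->; rewrite /coprimez gcdz0 /=;
  rewrite -[_ == _]/(p == 1%N); case: (p) p_pr => [|[]].
split; [by rewrite intr_eq0 | exact: pint_int | ].
exists `|z|%N; first by move: cz; rewrite coprimezE.
rewrite -[`|z|%:R]/(`|z|%:Z%:~R) abszE [`|z|%Z]normrEsign rmorphM /= mulfK ?intr_eq0 //.
by rewrite rpred_int.
Qed.

Lemma punit_dvdz (g c : int) : (p%:Z %| g * c - 1)%Z -> punit g%:~R.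
Proof.
move=> h; apply: punit_int; rewrite coprimezE prime_coprime //; apply/negP => pg.
have : (p%:Z %| g * c - (g * c - 1))%Z by rewrite rpredB // dvdz_mulr.
by rewrite subKr dvdzE /= dvdn1 => /eqP p1; have := p_pr; rewrite p1.
Qed.

Lemma punit_nat n : coprime p n -> punit n%:R.
Proof. exact: (@punit_int n). Qed.

Lemma punitM x y : punit x -> punit y -> punit (x * y).
Proof.
case=> x0 px pvx [y0 py pvy]; split; first by rewrite mulf_neq0.
  exact: pintM.
by rewrite invfM; apply: pintM.
Qed.

Lemma punitV x : punit x -> punit x^-1.
Proof. by case=> *; split; rewrite ?invr_eq0 ?invrK. Qed.

Lemma punitX x n : punit x -> punit (x ^+ n).
Proof.
move=> ux; elim: n => [|n IHn]; first exact: (@punit_nat 1 (coprimen1 p)).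
by rewrite exprS; apply: punitM.
Qed.

Lemma punit_prod (I : Type) (s : seq I) (P : pred I) (f : I -> algC) :
  (forall i, P i -> punit (f i)) -> punit (\prod_(i <- s | P i) f i).
Proof.
by move=> uf; elim/big_ind: _ => //; [exact: (@punit_nat 1 (coprimen1 p)) | exact: punitM].
Qed.

(** Integrality of both sides is part of the relation, so that congruences multiply without side
    conditions. *)
Definition cong k x y : Prop := [/\ pint x, pint y & pint ((x - y) / p%:R ^+ k)].

Let p0 k : p%:R ^+ k != 0 :> algC.
Proof. by rewrite expf_neq0 // pnatr_eq0 -lt0n prime_gt0. Qed.

Lemma cong_refl k x : pint x -> cong k x x.
Proof. by move=> px; split=> //; rewrite subrr mul0r; exact: (pint_int 0). Qed.

Lemma cong_sym k x y : cong k x y -> cong k y x.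
Proof. by case=> px py pxy; split=> //; rewrite -opprB mulNr; apply: pintN. Qed.

Lemma cong_trans k x y z : cong k x y -> cong k y z -> cong k x z.
Proof.
case=> px py pxy [_ pz pyz]; split=> //.
have -> : (x - z) / p%:R ^+ k = (x - y) / p%:R ^+ k + (y - z) / p%:R ^+ k.
  by ring.
exact: pintD.
Qed.

Lemma congD k x y x' y' : cong k x x' -> cong k y y' -> cong k (x + y) (x' + y').
Proof.
case=> px px' pxx' [py py' pyy']; split; [exact: pintD | exact: pintD | ].
by rewrite opprD addrACA mulrDl; apply: pintD.
Qed.

Lemma congN k x y : cong k x y -> cong k (- x) (- y).
Proof.
by case=> px py pxy; split; rewrite -?opprD ?mulNr; apply: pintN.
Qed.

Lemma congB k x y x' y' : cong k x x' -> cong k y y' -> cong k (x - y) (x' - y').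
Proof. by move=> cx cy; apply: congD => //; apply: congN. Qed.

Lemma congM k x y x' y' : cong k x x' -> cong k y y' -> cong k (x * y) (x' * y').
Proof.
case=> px px' pxx' [py py' pyy']; split; [exact: pintM | exact: pintM | ].
have -> : (x * y - x' * y') / p%:R ^+ k
    = (x - x') / p%:R ^+ k * y + x' * ((y - y') / p%:R ^+ k).
  by ring.
by apply: pintD; apply: pintM.
Qed.

Lemma congX k x y n : cong k x y -> cong k (x ^+ n) (y ^+ n).
Proof.
move=> cxy; elim: n => [|n IHn]; first exact: cong_refl (pint_int 1).
by rewrite !exprS; apply: congM.
Qed.

Lemma cong_sum k (I : Type) (s : seq I) (P : pred I) (f g : I -> algC) :
    (forall i, P i -> cong k (f i) (g i)) ->
  cong k (\sum_(i <- s | P i) f i) (\sum_(i <- s | P i) g i).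
Proof.
move=> fg; elim/big_ind2: _ => //; first exact: cong_refl (pint_int 0).
by move=> *; apply: congD.
Qed.

Lemma cong_prod k (I : Type) (s : seq I) (P : pred I) (f g : I -> algC) :
    (forall i, P i -> cong k (f i) (g i)) ->
  cong k (\prod_(i <- s | P i) f i) (\prod_(i <- s | P i) g i).
Proof.
move=> fg; elim/big_ind2: _ => //; first exact: cong_refl (pint_int 1).
by move=> *; apply: congM.
Qed.

Lemma cong_rising k x y n : cong k x y -> cong k (rising x n) (rising y n).
Proof.
move=> cxy; apply: cong_prod => i _; apply: congD => //.
exact: cong_refl (pint_nat i).
Qed.

Lemma congV k x y : punit x -> punit y -> cong k x y -> cong k x^-1 y^-1.
Proof.
move=> [x0 _ pvx] [y0 _ pvy] [_ _ pxy]; split=> //.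
have -> : (x^-1 - y^-1) / p%:R ^+ k = - (x^-1 * y^-1 * ((x - y) / p%:R ^+ k)).
  by have q0 := p0 k; set q := p%:R ^+ k in q0 *; field; rewrite x0 y0 q0.
by apply: pintN; apply: pintM => //; apply: pintM.
Qed.

Lemma cong_pow k x : pint x -> cong k (p%:R ^+ k * x) 0.
Proof.
move=> px; split; [|exact: (pint_int 0)|].
  by apply: pintM => //; apply/pintX/pint_nat.
by rewrite subr0 mulrC mulKf.
Qed.

Lemma cong_scale k n x y : cong k x y -> cong (n + k) (p%:R ^+ n * x) (p%:R ^+ n * y).
Proof.
have ppn := pintX n (pint_nat p).
case=> px py pxy; split; try exact: pintM.
have -> : (p%:R ^+ n * x - p%:R ^+ n * y) / p%:R ^+ (n + k) = (x - y) / p%:R ^+ k.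
  by rewrite exprD -mulrBr -mulf_div divff // mul1r.
by [].
Qed.

Lemma cong_dvdz (x y : int) : (p%:Z %| x - y)%Z -> cong 1 x%:~R y%:~R.
Proof.
move=> /dvdzP[c xy]; split; try exact: pint_int.
rewrite -rmorphB /= xy rmorphM /= expr1 mulfK; first exact: pint_int.
by rewrite -[p%:~R]/(p%:R) pnatr_eq0 -lt0n prime_gt0.
Qed.

(** A rational algebraic integer is an integer. Hence congruences proved with a root of unity in
    [algC] descend to the rationals. *)
Lemma pint_ratr (q : rat) : pint (ratr q) -> coprimez p (denq q).
Proof.
case=> n cn An.
have [z nq] : exists z : int, n%:R * q = z%:~R.
  have : n%:R * ratr q \in (Num.int : {pred algC}).
    by apply: Cint_rat_Aint => //; rewrite rpredM ?rpred_nat ?Crat_rat.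
  move=> /intrP[z]; rewrite -(ratr_nat algC n) -rmorphM /= -(ratr_int algC z).
  by move=> /fmorph_inj ->; exists z.
have E : n%:Z * numq q = z * denq q.
  apply/eqP; rewrite -(eqr_int rat) !rmorphM /= -nq.
  by rewrite numqE mulrA.
rewrite coprimezE absz_nat prime_coprime //; apply/negP => pd.
have : (p %| absz (n%:Z * numq q)%R)%N by rewrite E abszM dvdn_mull.
rewrite abszM Euclid_dvdM // => /orP[]; first
  by rewrite absz_nat -[(_ %| _)%N]negbK -prime_coprime // cn.
move=> pn; have := coprime_num_den q; rewrite /coprime => /eqP g1.
by have := dvdn_gcd p `|numq q| `|denq q|; rewrite pn pd g1 dvdn1; case: (p) p_pr => [|[]].
Qed.

Lemma cong_ratr k (x y : rat) : cong k (ratr x) (ratr y) -> padic_cong p k x y.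
Proof.
case=> px py pxy; rewrite /padic_cong.
have -> : coprimez p (denq (x - y)).
  by apply: pint_ratr; rewrite rmorphB /=; apply: pintB.
rewrite andbT; set d := x - y; pose q := d / p%:R ^+ k.
have cq : coprimez p (denq q).
  by apply: pint_ratr; rewrite fmorph_div /= rmorphB rmorphXn /= ratr_nat.
have q0 : p%:R ^+ k != 0 :> rat by rewrite expf_neq0 // pnatr_eq0 -lt0n prime_gt0.
have E : numq d * denq q = (p ^ k)%:Z * (numq q * denq d).
  apply/eqP; rewrite -(eqr_int rat) !rmorphM /= !numqE.
  rewrite -[(Posz _)%:~R]/((p ^ k)%:R) natrX /q; apply/eqP; field.
  exact: q0.
have : ((p ^ k)%:Z %| numq d * denq q)%Z by rewrite E dvdz_mulr.
rewrite mulrC Gauss_dvdzr //.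
by move: cq; rewrite !coprimezE !absz_nat => cq; rewrite coprimeXl.
Qed.

End LocalIntegrality.

(** * Morita's p-adic Gamma function modulo p *)

Section MoritaGamma.
Variable p : nat.
Hypothesis p_pr : prime p.

Lemma GammapS n : (0 < n)%N ->
  Gammap p n.+1 = (if (p %| n)%N then -1 else - n%:Z) * Gammap p n.
Proof.
move=> n0; rewrite /Gammap big_mkcond big_nat_recr //= -big_mkcond /= exprS.
by case: (p %| n)%N => /=; ring.
Qed.

(* Reduction modulo p of the reflection formula for the p-adic Gamma function. *)
Lemma Gammap_reflection n k : (0 < n)%N -> (k < p)%N -> (p %| n + k)%N ->
  (p%:Z %| Gammap p n * k`!%:Z - 1)%Z.
Proof.
move=> n0; elim: n n0 k => // n IHn _ k ltkp pnk.
have p1 := prime_gt1 p_pr.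
have wilson : (p%:Z %| (p.-1)`!%:Z + 1)%Z.
  by have := Wilson p1; rewrite p_pr dvdzE /= => /esym; rewrite addn1.
case: (posnP n) => [n0|n0].
  rewrite n0 in pnk *; have -> : k = p.-1.
    apply/eqP; rewrite eqn_leq; apply/andP; split; first by lia.
    by have := dvdn_leq (isT : (0 < 1 + k)%N) pnk; lia.
  rewrite /Gammap big_geq // expr1 mulr1 mulN1r -opprD dvdzE abszN -dvdzE.
  exact: wilson.
(* If p divides n, then k = p-1, the factor n is omitted from the product, and Wilson's theorem
   supplies the sign. Otherwise -n is congruent to k+1, and the induction hypothesis applies with
   k+1. *)
rewrite GammapS //; case: ifP => [pn|/negbT npn].
  have -> : k = p.-1.
    have : (p %| k.+1)%N by rewrite -(dvdn_addr _ pn) addnS -addSn.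
    by move/dvdn_leq => /(_ isT); lia.
  have := IHn n0 0%N (prime_gt0 p_pr); rewrite addn0 => /(_ pn); rewrite mulr1 => d1.
  have -> : -1 * Gammap p n * (p.-1)`!%:Z - 1
     = (Gammap p n - 1) - Gammap p n * ((p.-1)`!%:Z + 1) by ring.
  by rewrite rpredB // dvdz_mull.
have ltk1 : (k.+1 < p)%N.
  rewrite ltn_neqAle ltkp andbT; apply: contra npn => /eqP kp.
  by move: pnk; rewrite addSnnS kp dvdn_addl // dvdnn.
have d1 := IHn n0 k.+1 ltk1; rewrite -addSnnS in d1; move/(_ pnk) in d1.
have -> : - n%:Z * Gammap p n * k`!%:Z - 1
   = (Gammap p n * (k.+1)`!%:Z - 1) - (n.+1 + k)%N%:Z * (Gammap p n * k`!%:Z).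
  by rewrite factS PoszM !PoszD !intS; ring.
by rewrite rpredB // dvdz_mulr.
Qed.

(** The divisibility hypothesis on s says that 1 + s/3 is congruent to -k modulo p. The reflection
    formula is applied at a positive integer n close enough to 1 + s/3. *)
Lemma Gammap_approx_reflection K (s : int) (g : int) k :
    p != 3 -> (0 < K)%N -> Gammap_approx p K (1 + s%:~R / 3) g ->
    (k < p)%N -> (p%:Z %| s + 3 + 3 * k%:Z)%Z ->
  (p%:Z %| g * k`!%:Z - 1)%Z.
Proof.
move=> p3 K0 [M HM] ltkp pk.
have c3 : coprimez p 3.
  rewrite coprimezE /= prime_coprime //; apply: contra p3.
  by rewrite dvdn_prime2.
(* The exponent is M+1 rather than M so that n agrees with 1 + s/3 modulo p even when M = 0. *)
pose P := (p ^ M.+1)%:Z.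
have P0 : 0 < P by rewrite ltz_nat expn_gt0 prime_gt0.
have /coprimezP[[u v] /= uv] : coprimez 3 P.
  by rewrite coprimezE /= coprime_sym coprimeXl.
(* Here u is the inverse of 3 modulo P, and adding P makes the representative positive. *)
pose w := ((1 + s * u) %% P)%Z + P.
have w0 : 0 < w.
  by apply: ltr_wpDl => //; apply: modz_ge0; rewrite gt_eqF.
have [n nw] : exists n : nat, w = n%:Z by exists `|w|%N; rewrite gez0_abs // ltW.
have n0 : (0 < n)%N by rewrite -ltz_nat -nw.
have [c Ec] : exists c : int, 3 * n%:Z - 3 - s = P * c.
  exists (3 - 3 * ((1 + s * u) %/ P)%Z - s * v).
  have := divz_eq (1 + s * u) P; rewrite -nw /w => e.
  have -> : ((1 + s * u) %% P)%Z = (1 + s * u) - ((1 + s * u) %/ P)%Z * P.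
    by rewrite {2}e; ring.
  apply/eqP; rewrite -subr_eq0; apply/eqP.
  transitivity (s * (u * 3 + v * P - 1)); first by ring.
  by rewrite uv subrr mulr0.
have pP : (p%:Z %| P)%Z by rewrite dvdzE /= expnS dvdn_mulr.
have := HM n n0; have -> : padic_cong p M n%:R (1 + s%:~R / 3).
  apply: cong_ratr => //; have p3' := punit_nat p_pr (_ : coprime p 3).
  have {p3'} [_ _ pv3] := p3' ltac:(by move: c3; rewrite coprimezE).
  split; rewrite ?rmorphD ?rmorph1 ?fmorph_div /= ?ratr_int ?ratr_nat.
  - exact: pint_nat.
  - apply: pintD; [exact: (pint_int p 1) | apply: pintM => //; exact: pint_int].
  have -> : (n%:R - (1 + s%:~R / 3)) / p%:R ^+ M = (p%:Z * c)%:~R * 3^-1 :> algC.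
    have q0 : p%:R ^+ M != 0 :> algC.
      by rewrite expf_neq0 // pnatr_eq0 -lt0n prime_gt0.
    have : (3 * n%:Z - 3 - s)%:~R = (P * c)%:~R :> algC by rewrite Ec.
    rewrite !rmorphB !rmorphM /= -[P%:~R]/((p ^ M.+1)%:R) natrX exprS => e.
    apply: (mulIf q0); rewrite mulfVK //.
    transitivity ((3%:~R * (Posz n)%:~R - 3%:~R - s%:~R) / 3 :> algC).
      by rewrite -[(Posz n)%:~R]/(n%:R); field.
    by rewrite e -[p%:~R]/(p%:R); field.
  by apply: pintM => //; apply: pint_int.
move=> /(_ isT) dG.
have pnk : (p %| n + k)%N.
  have : (p%:Z %| 3 * (n + k)%N%:Z)%Z.
    have -> : 3 * (n + k)%N%:Z = (3 * n%:Z - 3 - s) + (s + 3 + 3 * k%:Z).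
      by rewrite PoszD; ring.
    by rewrite Ec rpredD // dvdz_mulr.
  by rewrite Gauss_dvdzr.
have := Gammap_reflection n0 ltkp pnk.
have pdG : (p%:Z %| Gammap p n - g)%Z.
  by apply: dvdz_trans dG; rewrite dvdzE /= -(prednK K0) expnS dvdn_mulr.
move=> d; have -> : g * k`!%:Z - 1
   = (Gammap p n * k`!%:Z - 1) - (Gammap p n - g) * k`!%:Z by ring.
by rewrite rpredB // dvdz_mulr.
Qed.

End MoritaGamma.

(** * Identities for a root of the fifth cyclotomic polynomial *)

Section FifthRoots.
Variables (R : comNzRingType) (z : R).
Hypothesis z_cyc : 1 + z + z ^+ 2 + z ^+ 3 + z ^+ 4 = 0.

Lemma prod_fifth_roots (y u : R) :
  (y + u) * (y + u * z) * (y + u * z ^+ 2) * (y + u * z ^+ 3) * (y + u * z ^+ 4)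
  = y ^+ 5 + u ^+ 5.
Proof.
apply/eqP; rewrite -subr_eq0; apply/eqP.
(* The second factor is the quotient of the difference of the two sides by the fifth cyclotomic
   polynomial in z; the next lemma is proved in the same way. *)
transitivity ((1 + z + z ^+ 2 + z ^+ 3 + z ^+ 4) *
  (z ^+ 6 * (y * u ^+ 4 + u ^+ 5) + z ^+ 5 * (y ^+ 2 * u ^+ 3 - u ^+ 5)
   + z ^+ 3 * (y ^+ 3 * u ^+ 2 + y ^+ 2 * u ^+ 3) + z * (y ^+ 3 * u ^+ 2 + u ^+ 5)
   + (y ^+ 4 * u - u ^+ 5))); first by ring.
by rewrite z_cyc mul0r.
Qed.

Lemma prod_pair_fifth_roots :
  (1 + 2 * (z + z ^+ 2)) * (1 + 2 * (z + z ^+ 3)) * (1 + 2 * (z + z ^+ 4)) = - 5.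
Proof.
apply/eqP; rewrite -subr_eq0; apply/eqP.
transitivity ((1 + z + z ^+ 2 + z ^+ 3 + z ^+ 4) *
  (8 * z ^+ 5 + 4 * z ^+ 3 + 8 * z ^+ 2 + 6)); first by ring.
by rewrite z_cyc mul0r.
Qed.

End FifthRoots.

(** * The supercongruence for primes p > 4, with r = 1 - e *)

Lemma rising_opp_nat (F : numFieldType) m k :
  rising (- m%:R : F) k = (-1) ^+ k * 'C(m, k)%:R * k`!%:R.
Proof.
elim: k => [|k IHk]; first by rewrite rising0 bin0 !mulr1.
rewrite risingS IHk exprS factS natrM.
have bl : k.+1%:R * 'C(m, k.+1)%:R = (m%:R - k%:R) * 'C(m, k)%:R :> F.
  rewrite -natrM mul_bin_left natrM; case: (leqP k m) => [le|lt]; first by rewrite natrB.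
  by rewrite bin_small // !mulr0.
transitivity (- (-1) ^+ k * k`!%:R * ((m%:R - k%:R) * 'C(m, k)%:R) : F); first by ring.
by rewrite -bl; ring.
Qed.

Lemma rising1 (R : comNzRingType) n : rising (1 : R) n = n`!%:R.
Proof.
elim: n => [|n IHn]; first by rewrite rising0.
by rewrite risingS IHn factS natrM nat1r mulrC.
Qed.

(* Here r = 1 - e, m = (2p - r)/3, l = (p - 2r)/3 and q = (p + r)/3 - 1, written
   without subtraction or division. *)
Section Supercongruence.
Variables p e m l q : nat.
Hypotheses (p_pr : prime p) (p_gt4 : (4 < p)%N) (e3 : ~~ (3 %| e + 2)%N).
Hypotheses (hm : (3 * m + 1 = 2 * p + e)%N) (hl : (3 * l + 2 = p + 2 * e)%N).
Hypothesis hq : (3 * q + 2 + e = p)%N.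

Local Notation a := ((1 - e%:R) / 3 : algC).
Local Notation t := (- (2 * p%:R) / 3 : algC).

Let natC (x y : nat) : x = y -> x%:R = y%:R :> algC.
Proof. by move->. Qed.

Lemma mE : m%:R = - a - t.
Proof.
have := natC hm; rewrite natrD (natrD _ (2 * p)%N) !natrM => h.
transitivity ((3 * m%:R + 1 - 1) / 3 : algC); first by field.
by rewrite h; field.
Qed.

Lemma lE : l%:R = p%:R / 3 - 2 * a.
Proof.
have := natC hl; rewrite natrD (natrD _ p) !natrM => h.
transitivity ((3 * l%:R + 2 - 2) / 3 : algC); first by field.
by rewrite h; field.
Qed.

Lemma qE : q%:R = p%:R / 3 - 1 + a.
Proof.
have := natC hq; rewrite natrD (natrD _ (3 * q)%N) natrM => h.
transitivity ((3 * q%:R + 2 + e%:R - 2 - e%:R) / 3 : algC); first by field.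
by rewrite h; field.
Qed.

Lemma a_neq0 n : a + n%:R != 0.
Proof.
apply: contra e3 => /eqP h.
have : (1 + 3 * n)%:R = e%:R :> algC.
  apply/eqP; rewrite -subr_eq0; apply/eqP.
  by transitivity (3 * (a + n%:R)); [field | rewrite h mulr0].
by move/eqP; rewrite eqr_nat => /eqP <-; apply/dvdnP; exists (n.+1); lia.
Qed.

Definition numer k : algC := \prod_(j < k) ((a + j%:R) ^+ 5 + t ^+ 5).
Definition denom k : algC := \prod_(j < k) ((1 + j%:R) ^+ 5 - t ^+ 5).
(** One of the six quotients (a)_k/k! stays undeformed: it carries the base parameter of the
    well-poised series. Stopping at m loses nothing, since [numer k] contains (a+t)_k = (-m)_k,
    which vanishes for k > m. *)
Definition deformed_sum : algC :=
  \sum_(k < m.+1) (6 * k%:R + (1 - e%:R)) * (rising a k / k`!%:R) * (numer k / denom k).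

Lemma coprime_small n : (0 < n < p)%N -> coprime p n.
Proof.
move=> /andP[n0 ltnp]; rewrite prime_coprime //; apply/negP => /dvdn_leq.
by move=> /(_ n0); rewrite leqNgt ltnp.
Qed.

Lemma punit_small n : (0 < n < p)%N -> punit p n%:R.
Proof. by move=> ?; apply: punit_nat => //; apply: coprime_small. Qed.

Lemma punit3 : punit p 3.
Proof. by apply: punit_small; lia. Qed.

Lemma punit_fact n : (n < p)%N -> punit p n`!%:R.
Proof.
move=> ltnp; rewrite -rising1; apply: punit_prod => // i _.
by rewrite nat1r; apply: punit_small; have := ltn_ord i; lia.
Qed.

Lemma punit_denom k : (k <= m)%N -> punit p (denom k).
Proof.
move=> lekm; apply: punit_prod => // -[j /= ltj] _.
have -> : (1 + j%:R) ^+ 5 - t ^+ 5 = ((3 * j.+1) ^ 5 + 32 * p ^ 5)%:R * (3^-1) ^+ 5.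
  by rewrite natrD natrX natrM natrM natrX; field.
apply: punitM; last by apply: punitX => //; apply: punitV punit3.
apply: punit_nat => //; rewrite prime_coprime // dvdn_addl; last first.
  by rewrite dvdn_mull // dvdn_exp.
rewrite Euclid_dvdX // Euclid_dvdM // negb_and negb_or.
rewrite -!prime_coprime // !coprime_small //; lia.
Qed.

(** * The deformed sum as a terminating very-well-poised 7F6 *)

Variable z : algC.
Hypothesis z_cyc : 1 + z + z ^+ 2 + z ^+ 3 + z ^+ 4 = 0.

Lemma numerE k : numer k = rising (a + t) k * rising (a + t * z) k
  * rising (a + t * z ^+ 2) k * rising (a + t * z ^+ 3) k * rising (a + t * z ^+ 4) k.
Proof.
rewrite /rising -!big_split; apply: eq_bigr => j _ /=.
by rewrite -(prod_fifth_roots z_cyc); ring.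
Qed.

Lemma denomE k : denom k = rising (1 - t) k * rising (1 - t * z) k
  * rising (1 - t * z ^+ 2) k * rising (1 - t * z ^+ 3) k * rising (1 - t * z ^+ 4) k.
Proof.
rewrite /rising -!big_split; apply: eq_bigr => j _ /=.
have -> : - t ^+ 5 = (- t) ^+ 5 by rewrite [RHS]exprNn; ring.
by rewrite -(prod_fifth_roots z_cyc); ring.
Qed.

Definition pair_sum j : algC := t * (z + z ^+ j).

(** [vwp7F6] with b, c, d, e equal to a + t z^i for i = 2, 3, 1, 4, while a+t = -m terminates the
    series. The 3 comes from 6k+r = 3(a+2k), and (1-t)_m is the factor of [denom m] left over
    because 1+a+m = 1-t. *)
Lemma deformed_sum_7F6 : deformed_sum * denom m
  = 3 * rising (1 - t) m * (rising a m.+1 *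
     \sum_(i < m.+1) 'C(m, i)%:R * rising (a + t * z) i * rising (t * z - m%:R) i
      * rising (- e%:R) i * rising (1 - a - pair_sum 2) (m - i)
      * rising (1 - a - pair_sum 3) (m - i) * rising (1 - a - pair_sum 4) (m - i)).
Proof.
have zE : z ^+ 4 = - 1 - z - z ^+ 2 - z ^+ 3.
  by apply/eqP; rewrite -subr_eq0 -z_cyc; apply/eqP; ring.
transitivity (3 * rising (1 - t) m * (rising a m.+1 *
    \sum_(i < m.+1) 'C(m, i)%:R * rising (a + t * z) i
      * rising ((a + t * z) - a - m%:R) i
      * rising ((a + t * z ^+ 2) + (a + t * z ^+ 3) + (a + t * z)
          + (a + t * z ^+ 4) - m%:R - 2 * a - 1) i
      * rising (1 + a - (a + t * z) - (a + t * z ^+ 2)) (m - i)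
      * rising (1 + a - (a + t * z) - (a + t * z ^+ 3)) (m - i)
      * rising (1 + a - (a + t * z) - (a + t * z ^+ 4)) (m - i))); last first.
  congr (_ * (_ * _)); apply: eq_bigr => i _.
  have -> : a + t * z - a - m%:R = t * z - m%:R by ring.
  (* Since z + z^2 + z^3 + z^4 = -1 and m = -a-t, the left side is 3a-1 = r-1. *)
  have -> : a + t * z ^+ 2 + (a + t * z ^+ 3) + (a + t * z)
          + (a + t * z ^+ 4) - m%:R - 2 * a - 1 = - e%:R.
    by rewrite zE mE; field.
  have E j : 1 + a - (a + t * z) - (a + t * z ^+ j) = 1 - a - pair_sum j.
    by rewrite /pair_sum; ring.
  by rewrite !E.
rewrite -vwp7F6; last exact: a_neq0.
rewrite mulr_sumr mulr_suml; apply: eq_bigr => -[k /= ltk] _.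
have lekm : (k <= m)%N by [].
have [nzB _ _] := punit_denom lekm.
have E x : rising (1 + a - (a + x) + k%:R) (m - k) = rising (1 - x + k%:R) (m - k).
  by congr (rising _ _); ring.
have splitm x : rising (1 - x) m = rising (1 - x) k * rising (1 - x + k%:R) (m - k).
  by rewrite -risingD subnKC.
rewrite !E /vwp (numerE k) (denomE m) !splitm.
have -> : 1 + a + m%:R = 1 - t by rewrite mE; ring.
have -> : a + t = - m%:R by rewrite mE; ring.
rewrite rising_opp_nat (denomE k) in nzB *.
move: nzB; rewrite !mulf_eq0 !negb_or -!andbA => /and5P[n0 n1 n2 n3 n4].
have kf : k`!%:R != 0 :> algC by rewrite pnatr_eq0 -lt0n fact_gt0.
have -> : 6 * k%:R + (1 - e%:R) = 3 * (a + (2 * k)%:R) by rewrite natrM; field.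
move: n0 n1 n2 n3 n4 kf.
move: (a + (2 * k)%:R) => w.
move: (rising (1 - t) k) (rising (1 - t * z) k) (rising (1 - t * z ^+ 2) k)
  (rising (1 - t * z ^+ 3) k) (rising (1 - t * z ^+ 4) k) => v0 v1 v2 v3 v4.
move: (rising a k) (rising (a + t * z) k) (rising (a + t * z ^+ 2) k)
  (rising (a + t * z ^+ 3) k) (rising (a + t * z ^+ 4) k) => u0 u1 u2 u3 u4.
move=> n0 n1 n2 n3 n4 kf.
by field; rewrite n0 n1 n2 n3 n4 kf.
Qed.

(** * Comparison with the original sum modulo p^5, and extraction of p^4 *)

Lemma pint_a : pint p a.
Proof.
by apply: pintM; [exact: pintB (pint_nat p 1) (pint_nat p e) | case: punit3].
Qed.

Lemma tE : t = p%:R * (- 2 / 3).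
Proof. by ring. Qed.

Lemma pint_t_factor : pint p (- 2 / 3).
Proof. by apply: pintM; [exact: (pint_int p (-2)) | case: punit3]. Qed.

Lemma cong_t x : pint p x -> cong p 1 (t * x) 0.
Proof.
move=> px; rewrite tE -mulrA -{1}[p%:R]expr1; apply: cong_pow => //.
exact: pintM pint_t_factor px.
Qed.

Lemma cong_t5 : cong p 5 (t ^+ 5) 0.
Proof.
by rewrite tE exprMn; apply: cong_pow => //; apply: pintX pint_t_factor.
Qed.

Lemma cong_numer k : cong p 5 (numer k) (rising a k ^+ 5).
Proof.
rewrite /rising -prodrXl; apply: cong_prod => j _; rewrite -[X in cong _ _ _ X]addr0.
apply: congD cong_t5; apply/cong_refl/pintX/pintD; [exact: pint_a | exact: pint_nat].
Qed.

Lemma cong_denom k : cong p 5 (denom k) (k`!%:R ^+ 5).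
Proof.
rewrite -rising1 /rising -prodrXl; apply: cong_prod => j _; rewrite -[X in cong _ _ _ X]subr0.
apply: congB cong_t5; apply/cong_refl/pintX/pintD; [exact: (pint_nat p 1) | exact: pint_nat].
Qed.

Lemma m_lt_p : (m < p)%N. Proof. lia. Qed.
Lemma e_le_m : (e <= m)%N. Proof. lia. Qed.

Lemma truncated_sum_cong :
  cong p 5 (\sum_(k < p) (6 * k%:R + (1 - e%:R)) * rising a k ^+ 6 / k`!%:R ^+ 6) deformed_sum.
Proof.
pose f k : algC := (6 * k%:R + (1 - e%:R)) * rising a k ^+ 6 / k`!%:R ^+ 6.
have ca k : pint p (6 * k%:R + (1 - e%:R)).
  apply: pintD; first by apply: pintM; [exact: (pint_nat p 6) | exact: pint_nat].
  exact: pintB (pint_nat p 1) (pint_nat p e).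
have pra x n : pint p x -> pint p (rising x n).
  by move=> px; case: (cong_rising n (cong_refl 1 px)).
have -> : \sum_(k < p) (6 * k%:R + (1 - e%:R)) * rising a k ^+ 6 / k`!%:R ^+ 6
    = \sum_(k < m.+1) f k + \sum_(m.+1 <= k < p) f k.
  by rewrite -(big_mkord predT f) -(big_mkord predT f) -big_cat_nat //; exact: m_lt_p.
rewrite -[deformed_sum]addr0; apply: congD.
  apply: cong_sum => -[k /= ltk] _; have lekm : (k <= m)%N by [].
  have uk := punit_fact (leq_ltn_trans lekm m_lt_p); have [k0 pk pkv] := uk.
  have -> : f k = (6 * k%:R + (1 - e%:R)) * (rising a k / k`!%:R)
      * (rising a k ^+ 5 / (k`!%:R ^+ 5)) by rewrite /f; field.
  apply: congM; first by apply/cong_refl/pintM/pintM => //; apply: pra pint_a.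
  apply: congM; first exact: cong_sym (cong_numer k).
  apply: congV => //; [exact: punitX | exact: punit_denom | exact: cong_sym (cong_denom k)].
suff: cong p 5 (\sum_(m.+1 <= k < p | (m < k < p)%N) f k)
    (\sum_(m.+1 <= k < p | (m < k < p)%N) 0).
  by rewrite -big_nat [X in cong _ _ _ X]big1.
apply: cong_sum => k /andP[ltmk ltkp].
have [k0 pk pkv] := punit_fact ltkp.
(* For m < k < p the product (a)_k contains the factor a+m = 2p/3, while k! is a unit, so the
   summand is even divisible by p^6. *)
pose w := rising a m * (2 / 3) * rising (a + m.+1%:R) (k - m.+1).
have -> : f k = p%:R ^+ 5 * ((6 * k%:R + (1 - e%:R)) * p%:R * w ^+ 6 * k`!%:R^-1 ^+ 6).
  rewrite /f -(subnKC ltmk) risingD risingS mE.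
  have -> : a + (- a - t) = p%:R * (2 / 3) by ring.
  rewrite (subnKC ltmk) /w; field; exact: k0.
apply: cong_pow => //; apply: pintM; last exact: pintX.
apply: pintM; first by apply: pintM => //; apply: pint_nat.
apply: pintX; apply: pintM; first apply: pintM; first exact: pra pint_a.
  by rewrite -[2 / 3]opprK -mulNr; apply: pintN pint_t_factor.
apply: pra; apply: pintD; [exact: pint_a | exact: pint_nat].
Qed.

(* The factor of index q of rising (1 - a - y) n is p/3 - y; for n <= m and y = 0
   it is the only one divisible by p, and the cofactor omits it. *)
Definition cofactor n y : algC :=
  rising (1 - a - y) q * rising (1 - a - y + q.+1%:R) (n - q.+1).

Lemma rising_cofactor n y : (q < n)%N ->
  rising (1 - a - y) n = (p%:R / 3 - y) * cofactor n y.
Proof.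
move=> ltqn; rewrite -{1}(subnKC ltqn) risingD risingS /cofactor.
have -> : 1 - a - y + q%:R = p%:R / 3 - y by rewrite qE; ring.
by rewrite mulrA [_ * rising _ q]mulrC.
Qed.

Definition reduced_sum : algC := rising (1 - t) m * rising a m *
  \sum_(i < e.+1) 'C(m, i)%:R * rising (a + t * z) i * rising (t * z - m%:R) i
      * rising (- e%:R) i * (cofactor (m - i) (pair_sum 2)
      * cofactor (m - i) (pair_sum 3) * cofactor (m - i) (pair_sum 4)).

(** The constant is the product of 3 from 6k+r = 3(a+2k), 2/3 from a+m = 2p/3, and -5/27 from the
    three factors p/3 - t(z + z^j). *)
Lemma deformed_sum_reduced :
  deformed_sum * denom m = p%:R ^+ 4 * (- (10 / 27) * reduced_sum).
Proof.
rewrite deformed_sum_7F6 /reduced_sum.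
pose f i := 'C(m, i)%:R * rising (a + t * z) i * rising (t * z - m%:R) i
      * rising (- e%:R) i * rising (1 - a - pair_sum 2) (m - i)
      * rising (1 - a - pair_sum 3) (m - i) * rising (1 - a - pair_sum 4) (m - i).
rewrite (big_ord_trunc (f := f) e_le_m) => [|i ltei]; last first.
  by rewrite /f rising_opp_eq0 // mulr0 !mul0r.
rewrite risingS mE; have -> : a + (- a - t) = p%:R * (2 / 3) by ring.
rewrite -mE !mulr_sumr; apply: eq_bigr => -[i /= lti] _.
(* As m = 2q+e+1 and i <= e, each of the three rising factorials does contain its factor of index
   q. *)
have ltq : (q < m - i)%N by lia.
rewrite /f !rising_cofactor //.
have E : (p%:R / 3 - pair_sum 2) * (p%:R / 3 - pair_sum 3) * (p%:R / 3 - pair_sum 4)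
    = (p%:R / 3) ^+ 3 * - 5.
  by rewrite -(prod_pair_fifth_roots z_cyc) /pair_sum; field.
set c := rising (a + _) i; set d := rising (t * z - _) i.
move: E; set u2 := _ - pair_sum 2; set u3 := _ - pair_sum 3; set u4 := _ - pair_sum 4 => E.
transitivity (3 * rising (1 - t) m * (rising a m * (p%:R * (2 / 3))
  * ('C(m, i)%:R * c * d * rising (- e%:R) i
    * (cofactor (m - i) (pair_sum 2) * cofactor (m - i) (pair_sum 3)
       * cofactor (m - i) (pair_sum 4)) * (u2 * u3 * u4)))).
  by ring.
by rewrite E; field.
Qed.

(** * Evaluation modulo p of the cofactor of p^4 *)

Hypothesis z_int : z \in Aint.

Definition target_sum : algC := \sum_(i < e.+1) rising (- e%:R) i * rising a i ^+ 3
  / (i`!%:R * rising (2 * a) i ^+ 3).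

Lemma pint_rising x n : pint p x -> pint p (rising x n).
Proof. by move=> px; case: (cong_rising n (cong_refl 1 px)). Qed.

Lemma sign_sqr n : (-1) ^+ n * (-1) ^+ n = 1 :> algC.
Proof. by rewrite -exprMn mulrNN mulr1 expr1n. Qed.

Lemma punit_sign n : punit p ((-1) ^+ n).
Proof.
apply: punitX => //; apply: (@punit_int p p_pr (-1)).
by rewrite coprimezE; exact: coprimen1.
Qed.

Lemma cong_opp_m : cong p 1 (- m%:R) a.
Proof.
have -> : - m%:R = t * 1 + a by rewrite mE; ring.
rewrite -[X in cong _ _ _ X]add0r; apply: congD (cong_refl _ pint_a).
by apply: cong_t; apply: (pint_nat p 1).
Qed.

Lemma punit_rising_2a i : (i <= e)%N -> punit p (rising (2 * a) i).
Proof.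
move=> leie; apply: punit_prod => // -[s /= lts] _.
pose v : int := 2 - 2 * e%:Z + 3 * s%:Z.
have -> : 2 * a + s%:R = v%:~R * 3^-1.
  by rewrite /v rmorphD rmorphB !rmorphM /= -[e%:~R]/(e%:R) -[s%:~R]/(s%:R); field.
apply: punitM; last exact: punitV punit3.
apply: punit_int => //; rewrite coprimezE prime_coprime //; apply/negP.
rewrite -[(_ %| _)%N]/(p%:Z %| v)%Z => /dvdzP[c vc].
(* From s < e < p one gets -2p < 2-2e <= v <= e-1 < p, so a multiple of p must be 0 or -p; either
   value would force 3 to divide e+2. *)
have c2 : -2 < c < 1 by rewrite /v in vc; nia.
have {c2} [c0|c1] : c = 0 \/ c = -1 by lia.
  by move: e3; rewrite /v c0 mul0r in vc; move/negP; apply; apply/dvdnP; exists (e - s)%N; lia.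
rewrite c1 /v in vc; move/negP: e3; apply; apply/dvdnP.
by exists (e - s - q)%N; lia.
Qed.

Lemma cong_cofactor n y : cong p 1 y 0 -> cong p 1 (cofactor n y) (cofactor n 0).
Proof.
move=> cy; have c1 : cong p 1 (1 - a - y) (1 - a - 0).
  by apply: congB => //; apply/cong_refl/pintB; [exact: (pint_nat p 1) | exact: pint_a].
apply: congM; apply: cong_rising => //; apply: congD => //.
exact/cong_refl/pint_nat.
Qed.

Lemma cofactor_shift i : (i <= e)%N ->
  cofactor m 0 = cofactor (m - i) 0 * ((-1) ^+ i * rising (a - m%:R) i).
Proof.
move=> leie; rewrite /cofactor -mulrA; congr (_ * _).
have -> : (m - q.+1 = (m - i - q.+1) + i)%N by lia.
rewrite risingD; congr (_ * _); rewrite rising_rev; congr (_ * rising _ _).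
by rewrite !natrB; first ring; lia.
Qed.

Lemma pint_cofactor n : pint p (cofactor n 0).
Proof.
by case: (cong_cofactor n (cong_refl 1 (pint_nat p 0))).
Qed.

(** The last i factors of [cofactor m 0], read backwards, give (-1)^i (a-m)_i, and -m is congruent
    to a. This is the origin of the denominators (2r/3)_k, cubed because there are three
    cofactors. *)
Lemma cong_cofactor_shift i : (i <= e)%N ->
  cong p 1 (cofactor (m - i) 0) (cofactor m 0 * ((-1) ^+ i / rising (2 * a) i)).
Proof.
move=> leie; have u2 := punit_rising_2a leie; have [n2 p2 pv2] := u2.
have [_ ps _] := punit_sign i.
rewrite (cofactor_shift leie).
have {1}-> : cofactor (m - i) 0 = cofactor (m - i) 0
    * ((-1) ^+ i * rising (2 * a) i) * ((-1) ^+ i / rising (2 * a) i).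
  transitivity (((-1) ^+ i * (-1) ^+ i) * cofactor (m - i) 0).
    by rewrite sign_sqr mul1r.
  by field.
apply: congM; last by apply/cong_refl/pintM.
apply: congM; first exact/cong_refl/pint_cofactor.
apply: congM; first exact: cong_refl.
apply: cong_rising; rewrite mulr_natl mulr2n; apply: congD; first exact/cong_refl/pint_a.
exact: cong_sym cong_opp_m.
Qed.

Lemma cong_bin i : (i <= e)%N -> cong p 1 'C(m, i)%:R ((-1) ^+ i * rising a i / i`!%:R).
Proof.
move=> leie; have [n0 _ pv] := punit_fact (leq_ltn_trans (leq_trans leie e_le_m) m_lt_p).
have -> : 'C(m, i)%:R = (-1) ^+ i * rising (- m%:R) i / i`!%:R :> algC.
  by rewrite rising_opp_nat !mulrA sign_sqr mul1r mulfK.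
have [_ ps _] := punit_sign i.
apply: congM (cong_refl _ pv); apply: congM (cong_refl _ ps) _.
exact: cong_rising cong_opp_m.
Qed.

Lemma reduced_sum_cong :
  cong p 1 reduced_sum (m`!%:R * rising a m * (cofactor m 0 ^+ 3 * target_sum)).
Proof.
have pz := pint_Aint p z_int.
have cpair j : cong p 1 (pair_sum j) 0.
  by apply/cong_t/pintD => //; apply: pintX.
have ca : cong p 1 (a + t * z) a.
  rewrite -[X in cong _ _ _ X]addr0; apply: congD (cong_t pz); exact/cong_refl/pint_a.
have ctm : cong p 1 (t * z - m%:R) a.
  rewrite -[X in cong _ _ _ X]add0r; apply: congD (cong_t pz) cong_opp_m.
apply: congM; first (apply: congM; last exact/cong_refl/pint_rising/pint_a).
  rewrite -rising1; apply: cong_rising; rewrite -[X in cong _ _ _ X]subr0 -[t]mulr1.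
  by apply: congB; [exact/cong_refl/(pint_nat p 1) | exact/cong_t/(pint_nat p 1)].
rewrite mulr_sumr; apply: cong_sum => -[i /= lti] _; have leie : (i <= e)%N by [].
have [n0 _ pv] := punit_fact (leq_ltn_trans (leq_trans leie e_le_m) m_lt_p).
have [n2 p2 pv2] := punit_rising_2a leie.
have cH j : cong p 1 (cofactor (m - i) (pair_sum j))
    (cofactor m 0 * ((-1) ^+ i / rising (2 * a) i)).
  exact: cong_trans (cong_cofactor _ (cpair j)) (cong_cofactor_shift leie).
have -> : cofactor m 0 ^+ 3 * (rising (- e%:R) i * rising a i ^+ 3
      / (i`!%:R * rising (2 * a) i ^+ 3))
  = ((-1) ^+ i * rising a i / i`!%:R) * rising a i * rising a i * rising (- e%:R) i
   * ((cofactor m 0 * ((-1) ^+ i / rising (2 * a) i))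
    * (cofactor m 0 * ((-1) ^+ i / rising (2 * a) i))
    * (cofactor m 0 * ((-1) ^+ i / rising (2 * a) i))).
  (* Four signs cancel: one from the binomial coefficient and three from the cofactors. *)
  transitivity (((-1) ^+ i * (-1) ^+ i) * ((-1) ^+ i * (-1) ^+ i)
     * (cofactor m 0 ^+ 3 * (rising (- e%:R) i * rising a i ^+ 3
      / (i`!%:R * rising (2 * a) i ^+ 3)))); first by rewrite sign_sqr !mul1r.
  by field; rewrite n0 n2.
apply: congM; last by apply: congM => //; apply: congM.
apply: congM; last exact/cong_refl/pint_rising/pintN/pint_nat.
apply: congM (cong_rising _ ctm); apply: congM (cong_rising _ ca).
exact: cong_bin.
Qed.

Lemma cong_wilson : cong p 1 (p.-1)`!%:R (- 1).
Proof.
apply: (@cong_dvdz p p_pr (p.-1)`!%:Z (-1)); rewrite opprK.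
by have := Wilson (prime_gt1 p_pr); rewrite p_pr dvdzE /= addn1 => <-.
Qed.

(** Modulo p the first q factors run from m+1 to m+q = p-1, giving (p-1)!/m!, and the l = m-q-1
    factors after the omitted one start at p/3 + 1 and give l!. Wilson's theorem supplies the
    sign. *)
Lemma cong_cofactor_fact : cong p 1 (cofactor m 0) (- (l`!%:R / m`!%:R)).
Proof.
have [n0 pm pv] := punit_fact m_lt_p.
have pl : pint p l`!%:R by exact: pint_nat.
have p1 := pint_nat p 1.
have -> : cofactor m 0 = cofactor m 0 * m`!%:R / m`!%:R by rewrite mulfK.
rewrite -mulNr; apply: congM (cong_refl _ pv).
rewrite -mulN1r; apply: (@cong_trans _ _ _ ((p.-1)`!%:R * l`!%:R)); last first.
  exact: congM cong_wilson (cong_refl _ pl).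
have -> : (p.-1)`!%:R * l`!%:R
    = rising (1 + m%:R) q * rising 1 l * m`!%:R :> algC.
  have -> : (p.-1 = m + q)%N by lia.
  by rewrite -!rising1 risingD; ring.
rewrite /cofactor; have -> : (m - q.+1 = l)%N by lia.
apply: congM (cong_refl _ pm); apply: congM; apply: cong_rising.
  have -> : 1 - a - 0 = t * 1 + (1 + m%:R) by rewrite mE; ring.
  rewrite -[X in cong _ _ _ X]add0r; apply: congD (cong_t p1) _.
  by apply/cong_refl/pintD => //; apply: pint_nat.
have -> : 1 - a - 0 + q.+1%:R = p%:R ^+ 1 * 3^-1 + 1.
  by rewrite -[q.+1%:R]natr1 qE expr1; ring.
rewrite -[X in cong _ _ _ X]add0r; apply: congD (cong_refl _ p1).
by apply: cong_pow => //; case: punit3.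
Qed.

(** By Wilson's theorem m! (p-1-m)! is congruent to 1 or -1, and the fourth power removes the
    sign. *)
Lemma cong_fact_reflection : cong p 1 ((p.-1 - m)`!%:R ^+ 4) (m`!%:R^-1 ^+ 4).
Proof.
have um := punit_fact m_lt_p; have [n0 pm pv] := um; pose n := (p.-1 - m)%N.
have pmn : (p.-1 = m + n)%N by rewrite /n; lia.
have c1 : cong p 1 (p.-1)`!%:R (m`!%:R * ((-1) ^+ n * n`!%:R)).
  rewrite pmn -rising1 risingD rising1; apply: congM (cong_refl _ pm) _.
  rewrite rising_rev; apply: congM; first by case: (punit_sign n) => *; apply: cong_refl.
  rewrite -rising1; apply: cong_rising.
  have -> : 1 - (1 + m%:R) - n%:R = p%:R ^+ 1 * (- 1) + 1 :> algC.
    have -> : p%:R = (m + n).+1%:R :> algC by rewrite -pmn prednK // prime_gt0.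
    by rewrite expr1 -[(m + n).+1%:R]natr1 natrD; ring.
  rewrite -[X in cong _ _ _ X]add0r; apply: congD (cong_refl _ (pint_nat p 1)).
  by apply: cong_pow => //; apply: (pint_int p (-1)).
have c2 := congX 4 (cong_trans (cong_sym cong_wilson) c1).
have c3 := congM (cong_sym c2) (cong_refl 1 (pintX 4 pv)).
have -> : m`!%:R^-1 ^+ 4 = (- 1) ^+ 4 * m`!%:R^-1 ^+ 4 :> algC by ring.
have -> : (p.-1 - m)`!%:R ^+ 4 = (m`!%:R * ((-1) ^+ n * n`!%:R)) ^+ 4 * m`!%:R^-1 ^+ 4 :> algC.
  transitivity (((-1) ^+ n * (-1) ^+ n) ^+ 2 * n`!%:R ^+ 4 : algC).
    by rewrite sign_sqr expr1n mul1r.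
  by field.
exact: c3.
Qed.

(** The integers g1, g2, g3 represent the p-adic Gamma values at 1+r/3, 1+2r/3, 1-r/3, whose
    arguments are congruent to -(m-1), -(l-1), -(p-1-m). Both sides are reduced to factorials of m
    and l-1. *)
Lemma constant_cong (g1 g2 g3 : int) :
    (p%:Z %| g1 * m.-1`!%:Z - 1)%Z -> (p%:Z %| g2 * l.-1`!%:Z - 1)%Z ->
    (p%:Z %| g3 * (p.-1 - m)`!%:Z - 1)%Z ->
  cong p 1 (- (10 / 27) * (m`!%:R * rising a m * cofactor m 0 ^+ 3) / m`!%:R ^+ 5)
    ((-1) ^+ e * 80 * (1 - e%:R) / 81 * (g1%:~R ^+ 2 / (g2%:~R ^+ 3 * g3%:~R ^+ 4))).
Proof.
move=> h1 h2 h3.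
have [m0 l0] : (0 < m)%N /\ (0 < l)%N by lia.
have inv_cong (g : int) k : (k < p)%N -> (p%:Z %| g * k`!%:Z - 1)%Z ->
    punit p g%:~R /\ cong p 1 g%:~R (k`!%:R^-1).
  move=> ltk h; have [k0 pk pkv] := punit_fact ltk.
  split; first exact: punit_dvdz h.
  have := congM (cong_dvdz p_pr h) (cong_refl 1 pkv).
  by rewrite rmorphM /= mulfK // mul1r.
have [u1 c1] := inv_cong g1 m.-1 ltac:(lia) h1.
have [u2 c2] := inv_cong g2 l.-1 ltac:(lia) h2.
have [u3 c3] := inv_cong g3 (p.-1 - m)%N ltac:(lia) h3.
have um := punit_fact m_lt_p; have [n0 pm pv] := um.
have um1 : punit p m.-1`!%:R by apply: punit_fact; lia.
have ul1 : punit p l.-1`!%:R by apply: punit_fact; lia.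
have un1 : punit p (p.-1 - m)`!%:R by apply: punit_fact; lia.
have [n1 _ pv1] := um1; have [nl pl1 _] := ul1.
have [_ ps _] := punit_sign e.
have [_ _ p3] := punit3.
have p27 : pint p (27^-1) by rewrite (_ : 27^-1 = 3^-1 ^+ 3); [exact: pintX | field].
have p81 : pint p (81^-1) by rewrite (_ : 81^-1 = 3^-1 ^+ 4); [exact: pintX | field].
apply: (@cong_trans _ _ _ (- (10 / 27) * (m`!%:R * ((-1) ^+ m * m`!%:R)
    * (- (l`!%:R / m`!%:R)) ^+ 3) / m`!%:R ^+ 5)).
  apply: congM; last by rewrite -exprVn; apply/cong_refl/pintX.
  apply: congM.
    by apply/cong_refl/pintN/pintM => //; exact: (pint_nat p 10).
  apply: congM; last exact: congX cong_cofactor_fact.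
  apply: congM (cong_refl _ pm) _.
  have -> : (-1) ^+ m * m`!%:R = rising (- m%:R) m :> algC.
    by rewrite rising_opp_nat binn mulr1.
  exact/cong_rising/cong_sym/cong_opp_m.
apply: (@cong_trans _ _ _ ((-1) ^+ e * 80 * (3 * - m%:R) / 81 *
   ((m.-1`!%:R^-1) ^+ 2 * (l.-1`!%:R ^+ 3 * m`!%:R^-1 ^+ 4)))); last first.
  apply: congM.
    apply: congM (cong_refl _ p81); apply: congM.
      by apply/cong_refl/pintM => //; exact: (pint_nat p 80).
    have -> : 1 - e%:R = 3 * a by field.
    by apply: congM cong_opp_m; apply/cong_refl/(pint_nat p 3).
  apply: congM; first by apply: congX; apply: cong_sym.
  rewrite invfM; apply: congM.
    rewrite -exprVn; apply: congX; rewrite -[l.-1`!%:R]invrK.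
    by apply: cong_sym; apply: congV => //; apply: punitV.
  apply: cong_trans (cong_sym cong_fact_reflection) _.
  rewrite -exprVn; apply: congX; rewrite -[(p.-1 - m)`!%:R]invrK.
  by apply: cong_sym; apply: congV => //; apply: punitV.
(* Since 2m = p + l, the factor l^3 of l!^3 becomes 8m^3; with r congruent to -3m, the constants
   match through 8 * 10/27 = 3 * 80/81. *)
have cl : cong p 1 l%:R (2 * m%:R).
  have -> : 2 * m%:R = p%:R ^+ 1 * 1 + l%:R :> algC by rewrite mE lE expr1; field.
  rewrite -[X in cong _ _ X _]add0r; apply: congD; last exact/cong_refl/pint_nat.
  by apply/cong_sym/cong_pow => //; exact: (pint_nat p 1).
have -> : l`! = (l * l.-1`!)%N by rewrite -{1}(prednK l0) factS prednK.
have mf : m`!%:R = m%:R * m.-1`!%:R :> algC.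
  by rewrite -natrM -{1}(prednK m0) factS prednK.
have mn0 : m%:R != 0 :> algC by rewrite pnatr_eq0 -lt0n.
have -> : (-1) ^+ e * 80 * (3 * - m%:R) / 81 *
   ((m.-1`!%:R^-1) ^+ 2 * (l.-1`!%:R ^+ 3 * m`!%:R^-1 ^+ 4))
  = (10 / 27) * (-1) ^+ m * ((2 * m%:R) * l.-1`!%:R) ^+ 3 * m`!%:R^-1 ^+ 6 :> algC.
  (* By parity in 3m+1 = 2p+e. *)
  have -> : (-1) ^+ e = - (-1) ^+ m :> algC.
    have -> : (-1) ^+ e = (-1) ^+ (2 * p + e) :> algC.
      by rewrite exprD exprM sqrrN !expr1n mul1r.
    by rewrite -hm exprD exprM (_ : (-1) ^+ 3 = -1) //; ring.
  by rewrite mf; field; rewrite mn0 n1.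
have -> : - (10 / 27) * (m`!%:R * ((-1) ^+ m * m`!%:R)
    * (- ((l * l.-1`!)%:R / m`!%:R)) ^+ 3) / m`!%:R ^+ 5
  = (10 / 27) * (-1) ^+ m * (l%:R * l.-1`!%:R) ^+ 3 * m`!%:R^-1 ^+ 6 :> algC.
  by rewrite natrM; field.
apply: congM; last by apply/cong_refl/pintX.
apply: congM; last by apply: congX; apply: congM (cong_refl _ pl1).
apply/cong_refl/pintM; last by case: (punit_sign m).
by apply: pintM => //; exact: (pint_nat p 10).
Qed.

Lemma main_congruence (g1 g2 g3 : int) :
    (p%:Z %| g1 * m.-1`!%:Z - 1)%Z -> (p%:Z %| g2 * l.-1`!%:Z - 1)%Z ->
    (p%:Z %| g3 * (p.-1 - m)`!%:Z - 1)%Z ->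
  cong p 5 (\sum_(k < p) (6 * k%:R + (1 - e%:R)) * rising a k ^+ 6 / k`!%:R ^+ 6)
    (p%:R ^+ 4 * ((-1) ^+ e * 80 * (1 - e%:R) / 81
       * (g1%:~R ^+ 2 / (g2%:~R ^+ 3 * g3%:~R ^+ 4)) * target_sum)).
Proof.
move=> h1 h2 h3; apply: cong_trans truncated_sum_cong _.
have uB := punit_denom (leqnn m); have [B0 pB pvB] := uB.
have -> : deformed_sum = p%:R ^+ 4 * (- (10 / 27) * reduced_sum / denom m).
  by rewrite -(mulfK B0 deformed_sum) deformed_sum_reduced !mulrA.
(* With p^4 in front of both sides, a congruence modulo p suffices. *)
apply: (@cong_scale p p_pr 1 4).
have um := punit_fact m_lt_p; have [n0 pm pv] := um.
have ps : pint p target_sum.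
  apply: pint_sum => -[i /= lti] _; have leie : (i <= e)%N by [].
  have [k0 _ pv1] := punit_fact (leq_ltn_trans (leq_trans leie e_le_m) m_lt_p).
  have [n2 p2 pv2] := punit_rising_2a leie.
  apply: pintM.
    by apply: pintM; [exact/pint_rising/pintN/pint_nat | exact/pintX/pint_rising/pint_a].
  by rewrite invfM -exprVn; apply: pintM => //; apply: pintX.
apply: (@cong_trans _ _ _ (- (10 / 27) * (m`!%:R * rising a m * (cofactor m 0 ^+ 3
   * target_sum)) / m`!%:R ^+ 5)).
  apply: congM; last first.
    apply: congV => //; first exact: punitX.
    have [pd pf pdf] := cong_denom m; split=> //.
    rewrite (_ : _ / _ = p%:R ^+ 4 * ((denom m - m`!%:R ^+ 5) / p%:R ^+ 5)).
      by apply: pintM => //; apply/pintX/pint_nat.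
    have p0 : p%:R != 0 :> algC by rewrite pnatr_eq0 -lt0n prime_gt0.
    by field.
  apply: congM reduced_sum_cong; apply/cong_refl/pintN/pintM; first exact: (pint_nat p 10).
  by rewrite (_ : 27^-1 = 3^-1 ^+ 3); [apply: pintX; case: punit3 | field].
have -> : - (10 / 27) * (m`!%:R * rising a m * (cofactor m 0 ^+ 3
   * target_sum)) / m`!%:R ^+ 5 = - (10 / 27) * (m`!%:R * rising a m
   * cofactor m 0 ^+ 3) / m`!%:R ^+ 5 * target_sum by field.
by apply: congM (cong_refl _ ps); apply: constant_cong.
Qed.

End Supercongruence.

(** * Return to the rationals, and the prime 2 *)

Lemma ratr_poch x k : ratr (poch x k) = rising (ratr x) k :> algC.
Proof.
rewrite /poch /rising rmorph_prod; apply: eq_bigr => i _.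
by rewrite rmorphD /= ratr_nat.
Qed.

Lemma pint_gamma_quotient p (g1 g2 g3 : int) : prime p -> punit p g2%:~R -> punit p g3%:~R ->
  pint p (g1%:~R ^+ 2 / (g2%:~R ^+ 3 * g3%:~R ^+ 4)).
Proof.
move=> p_pr u2 u3; apply: pintM; first by apply/pintX/pint_int.
by have [] : punit p (g2%:~R ^+ 3 * g3%:~R ^+ 4) by apply: punitM; apply: punitX.
Qed.

Theorem theorem2 (r : int) (p : nat) (g1 g2 g3 : int) :
  r <= 1 -> coprimez r 3 ->
  prime p -> (p%:Z = - r %[mod 3])%Z -> 3 - r <= p%:Z ->
  Gammap_approx p 5 (1 + r%:~R / 3) g1 ->
  Gammap_approx p 5 (1 + 2 * r%:~R / 3) g2 ->
  Gammap_approx p 5 (1 - r%:~R / 3) g3 ->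
  padic_cong p 5
    (\sum_(k < p) (6 * k%:R + r%:~R) * poch (r%:~R / 3) k ^+ 6
                    / (k`!)%:R ^+ 6)
    ((-1 : rat) ^ (r + 1) * 80 * r%:~R * p%:R ^+ 4 / 81
       * (g1%:~R ^+ 2 / (g2%:~R ^+ 3 * g3%:~R ^+ 4))
       * \sum_(k < (absz (1 - r)).+1)
           (poch (r%:~R - 1) k * poch (r%:~R / 3) k ^+ 3
             / (poch 1 k * poch (2 * r%:~R / 3) k ^+ 3))).
Proof.
move=> r1 cr p_pr prm pr hg1 hg2 hg3.
have [e re] : exists e : nat, r = 1 - e%:Z.
  by exists (absz (1 - r)); rewrite gez0_abs ?subr_ge0 // subKr.
have e3 : ~~ (3 %| e + 2)%N.
  apply: contraTN cr => /dvdnP[c ec]; rewrite coprimez_sym coprimezE prime_coprime //.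
  by rewrite negbK -[(_ %| _)%N]/(3 %| r)%Z; apply/dvdzP; exists (1 - c%:Z); lia.
have [q hq] : exists q, (3 * q + 2 + e = p)%N.
  move/eqP: prm; rewrite eqz_mod_dvd opprK re => /dvdzP[c hc].
  by exists `|c - 1|%N; lia.
have p3 : p != 3.
  by apply: contra e3 => /eqP p3; apply/dvdnP; exists (1 - q)%N; lia.
have gamma2 : 1 + 2 * r%:~R / 3 = 1 + (2 * r)%:~R / 3 :> rat by rewrite rmorphM.
have gamma3 : 1 - r%:~R / 3 = 1 + (- r)%:~R / 3 :> rat by rewrite rmorphN mulNr.
rewrite gamma2 in hg2; rewrite gamma3 in hg3.
have -> : (absz (1 - r)).+1 = e.+1 by rewrite re subKr absz_nat.
have ratr_r : ratr r%:~R = 1 - e%:R :> algC by rewrite ratr_int re rmorphB.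
have sgn : (-1 : rat) ^ (r + 1) = (-1) ^+ e.
  rewrite re addrAC expfzDr // -invr_expz -[_ ^ (1 + 1)]/((-1) ^+ 2) sqrrN expr1n mul1r.
  by rewrite -[_ ^ e]/((-1) ^+ e) invr_sign.
rewrite sgn; apply: cong_ratr => //.
have ratr_lhs : ratr (\sum_(k < p) (6 * k%:R + r%:~R) * poch (r%:~R / 3) k ^+ 6
                    / (k`!)%:R ^+ 6)
   = \sum_(k < p) (6 * k%:R + (1 - e%:R)) * rising ((1 - e%:R) / 3) k ^+ 6
                    / (k`!)%:R ^+ 6 :> algC.
  rewrite rmorph_sum; apply: eq_bigr => k _.
  rewrite fmorph_div rmorphM rmorphD rmorphM !rmorphXn /= ratr_poch !ratr_nat.
  by rewrite fmorph_div /= ratr_r ratr_nat.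
have ratr_rhs : ratr ((-1) ^+ e * 80 * r%:~R * p%:R ^+ 4 / 81
       * (g1%:~R ^+ 2 / (g2%:~R ^+ 3 * g3%:~R ^+ 4))
       * \sum_(k < e.+1)
           (poch (r%:~R - 1) k * poch (r%:~R / 3) k ^+ 3
             / (poch 1 k * poch (2 * r%:~R / 3) k ^+ 3)))
   = p%:R ^+ 4 * ((-1) ^+ e * 80 * (1 - e%:R) / 81
       * (g1%:~R ^+ 2 / (g2%:~R ^+ 3 * g3%:~R ^+ 4)) * target_sum e).
  have -> : target_sum e = ratr (\sum_(k < e.+1)
           (poch (r%:~R - 1) k * poch (r%:~R / 3) k ^+ 3
             / (poch 1 k * poch (2 * r%:~R / 3) k ^+ 3))).
    rewrite rmorph_sum; apply: eq_bigr => k _.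
    apply: esym; rewrite [LHS]fmorph_div rmorphM rmorphXn rmorphM rmorphXn /= !ratr_poch.
    rewrite !fmorph_div rmorphB rmorphM /= ratr_r rmorph1 rising1 !ratr_nat.
    by rewrite [1 - _ - 1]addrAC subrr sub0r !mulrA.
  have ratr_G : ratr (g1%:~R ^+ 2 / (g2%:~R ^+ 3 * g3%:~R ^+ 4))
      = g1%:~R ^+ 2 / (g2%:~R ^+ 3 * g3%:~R ^+ 4) :> algC.
    by rewrite fmorph_div rmorphXn rmorphM 2!rmorphXn /= !ratr_int.
  have ratr_s : ratr ((-1) ^+ e) = (-1) ^+ e :> algC by rewrite rmorphXn rmorphN1.
  have ratr_p : ratr (p%:R ^+ 4) = p%:R ^+ 4 :> algC by rewrite rmorphXn /= ratr_nat.
  have ratr_V : ratr 81^-1 = 81^-1 :> algC by rewrite fmorphV /= ratr_nat.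
  rewrite 6!rmorphM /= ratr_s ratr_p ratr_V ratr_G ratr_r ratr_nat.
  by move: (ratr _) (_ / (_ * _)) => S G; ring.
rewrite ratr_lhs ratr_rhs.
(* The only small prime left is 2, which forces r = 1. Both sides then vanish modulo 2^5: the left
   one is 1 + 7/3^6 = 2^5 * 23/3^6, and the right one contains 80 * 2^4, its Gamma denominators
   being odd by the reflection formula. *)
case: (ltnP 4 p) => [p4|p4]; last first.
  have p2 : p = 2%N by case: (p) p_pr p3 p4 => [|[|[|[|[|?]]]]].
  have e0 : e = 0%N by lia.
  rewrite p2 e0 in p_pr hg2 hg3 re *.
  have u2 : punit 2 g2%:~R.
    apply: (punit_dvdz (c := 1`!) p_pr).
    by apply: (Gammap_approx_reflection _ _ _ hg2) => //; rewrite re.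
  have u3 : punit 2 g3%:~R.
    apply: (punit_dvdz (c := 0`!) p_pr).
    by apply: (Gammap_approx_reflection _ _ _ hg3) => //; rewrite re.
  have [_ _ pv3] := @punit_nat 2 p_pr 3 isT.
  apply: (@cong_trans _ _ _ 0).
    have -> : \sum_(k < 2) (6 * k%:R + (1 - 0%:R)) * rising ((1 - 0%:R) / 3) k ^+ 6
                    / (k`!)%:R ^+ 6 = 2%:R ^+ 5 * (23%:R * 3^-1 ^+ 6) :> algC.
      by rewrite !big_ord_recr big_ord0 /= risingS !rising0 !factS fact0; field.
    by apply: cong_pow => //; apply: pintM; [exact: pint_nat | exact: pintX].
  apply: cong_sym.
  have -> : target_sum 0 = 1.
    by rewrite /target_sum big_ord1 /= !rising0 fact0; field.
  have pG := pint_gamma_quotient g1 p_pr u2 u3; move: pG; move: (_ / _) => G pG.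

  have -> : 2%:R ^+ 4 * ((-1) ^+ 0 * 80 * (1 - 0%:R) / 81 * G * 1)
     = 2%:R ^+ 5 * (40%:R * 3^-1 ^+ 4 * G).
    by rewrite expr0 mulr0n subr0; field.
  apply: cong_pow => //; apply: pintM => //.
  by apply: pintM; [exact: pint_nat | exact: pintX].
have [m hm] : exists m, (3 * m + 1 = 2 * p + e)%N by exists (2 * q + e + 1)%N; lia.
have [l hl] : exists l, (3 * l + 2 = p + 2 * e)%N by exists (q + e)%N; lia.
have [z zprim] := C_prim_root_exists (isT : (0 < 5)%N).
have z_cyc : 1 + z + z ^+ 2 + z ^+ 3 + z ^+ 4 = 0.
  have z1 : z != 1 by apply/eqP => z1; have := prim_order_dvd zprim 1; rewrite z1 expr1n eqxx.
  apply: (mulfI (_ : z - 1 != 0)); first by rewrite subr_eq0.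
  transitivity (z ^+ 5 - 1); first by ring.
  by rewrite (prim_expr_order zprim) subrr mulr0.
apply: (main_congruence p_pr p4 e3 hm hl hq z_cyc (Aint_prim_root zprim)).
(* The multipliers 2, 1, 1 come from r + 3m = 2p, 2r + 3l = p and 3p - r - 3m = p. *)
- by apply: (Gammap_approx_reflection _ _ _ hg1) => //; [lia | apply/dvdzP; exists 2; lia].
- by apply: (Gammap_approx_reflection _ _ _ hg2) => //; [lia | apply/dvdzP; exists 1; lia].
- by apply: (Gammap_approx_reflection _ _ _ hg3) => //; [lia | apply/dvdzP; exists 1; lia].
Qed.
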